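(* Let $v\colon[0,T]\times\mathbb{R}^d\to\mathbb{R}^d$ and $w\colon[0,T]\times\mathbb{R}^d\to\mathbb{R}$ be Borel maps and let $\eta$ be a non-negative finite Borel measure on $\mathcal{C}([0,T];\mathfrak{C}[\mathbb{R}^d])$ concentrated on curves $\gamma=[x_\gamma,r_\gamma]\in\mathcal{AC}^2([0,T];\mathfrak{C}[\mathbb{R}^d])$ satisfying, with $k_\gamma=r_\gamma^2$, $$x_\gamma'(t)=v_t(x_\gamma(t)),\qquad k_\gamma'(t)=w_t(x_\gamma(t))\,k_\gamma(t)\qquad\text{for a.e. }t\in r_\gamma^{-1}\big((0,\infty)\big).$$ Set $\mu_t=h_t^2(\eta)$ for $t\in[0,T]$. If $$\int_0^T\int_{\mathbb{R}^d}\big[1+|v_t|+|w_t|\big]\,\mathrm{d}\mu_t\,\mathrm{d}t<\infty,$$ then $\mu\in\mathcal{C}([0,T];\mathscr{M}_+(\mathbb{R}^d))$ and $\mu$ solves $$\partial_t\mu+\mathrm{div}(v\mu)=w\mu\quad\text{in }\mathcal{D}'((0,T)\times\mathbb{R}^d).$$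
   Context: $d\ge1$ is an integer and $T\in(0,\infty)$. $\mathscr{M}_+(\mathbb{R}^d)$ is the set of non-negative finite Borel measures on $\mathbb{R}^d$ with the narrow topology (convergence against bounded continuous functions); $\mathcal{C}([0,T];\mathscr{M}_+(\mathbb{R}^d))$ is the set of narrowly continuous curves. $v_t=v(t,\cdot)$, $w_t=w(t,\cdot)$. The equation in $\mathcal{D}'((0,T)\times\mathbb{R}^d)$ means $\int_0^T\int_{\mathbb{R}^d}\big[\partial_t\zeta_t+\langle\nabla\zeta_t,v_t\rangle+\zeta_tw_t\big]\,\mathrm{d}\mu_t\,\mathrm{d}t=0$ for every $\zeta\in\mathcal{C}_c^\infty((0,T)\times\mathbb{R}^d)$. The geometric cone is the quotient $\mathfrak{C}[\mathbb{R}^d]=(\mathbb{R}^d\times[0,\infty))/(\mathbb{R}^d\times\{0\})$, with points $[x,r]$; all points with $r=0$ are identified with a single vertex $\mathfrak{o}$. It is endowed with the distance $\mathsf{d}_{\mathfrak{C}}([x_0,r_0],[x_1,r_1])^2=r_0^2+r_1^2-2r_0r_1\cos(|x_0-x_1|\wedge\pi)$. The space $\mathcal{C}([0,T];\mathfrak{C}[\mathbb{R}^d])$ carries the uniform distance induced by $\mathsf{d}_{\mathfrak{C}}$. A curve $\gamma$ is written $\gamma_t=[x_\gamma(t),r_\gamma(t)]$, with $x_\gamma(t)$ uniquely determined when $r_\gamma(t)>0$. $\mathcal{AC}^2([0,T];\mathfrak{C}[\mathbb{R}^d])$ is the (Borel) subset of absolutely continuous curves with metric derivative in $L^2([0,T])$;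 for such curves $x_\gamma$ is locally absolutely continuous on $r_\gamma^{-1}((0,\infty))$ and $r_\gamma$ is absolutely continuous on $[0,T]$. A measure is concentrated on a set if the complement of that set is negligible for it. For $t\in[0,T]$, $h_t^2(\eta)$ is the (a priori possibly infinite) non-negative Borel measure on $\mathbb{R}^d$ defined by $\int_{\mathbb{R}^d}\phi\,\mathrm{d}h_t^2(\eta)=\int\phi(x_\gamma(t))\,r_\gamma^2(t)\,\mathrm{d}\eta(\gamma)$ for non-negative Borel $\phi$, the integrand being $0$ when $r_\gamma(t)=0$. *)

(* Defs.v *)
From HB Require Import structures.
From mathcomp Require Import all_boot all_order all_algebra generic_quotient.
From mathcomp Require Import all_classical all_reals all_analysis.
From mathcomp Require Import measurable_realfun.
From mathcomp Require Import ring lra.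

Set Implicit Arguments.
Unset Strict Implicit.
Unset Printing Implicit Defensive.

Import Order.TTheory GRing.Theory Num.Theory.
Import numFieldTopology.Exports numFieldNormedType.Exports.

Local Open Scope quotient_scope.
Local Open Scope classical_set_scope.
Local Open Scope ring_scope.

(* The library norm on ['rV[R]_d] is the sup norm; the Euclidean one is needed
   in the cone distance. *)
Section euclidean.
Context {R : realType} {d : nat}.
Implicit Types x y z : 'rV[R]_d.

Definition dotp x y : R := \sum_i x 0 i * y 0 i.

Definition enorm x : R := Num.sqrt (dotp x x).

Lemma dotpp_ge0 x : 0 <= dotp x x.
Proof. by apply: sumr_ge0 => i _; rewrite -expr2 sqr_ge0. Qed.

Lemma enorm_ge0 x : 0 <= enorm x. Proof. exact: sqrtr_ge0. Qed.

Lemma enorm0 : enorm 0 = 0.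
Proof.
by rewrite /enorm /dotp big1 ?sqrtr0// => i _; rewrite mxE mulr0.
Qed.

Lemma enormN x : enorm (- x) = enorm x.
Proof.
by rewrite /enorm /dotp; congr Num.sqrt; apply: eq_bigr => i _; rewrite mxE mulrNN.
Qed.

Lemma enorm_distC x y : enorm (x - y) = enorm (y - x).
Proof. by rewrite -enormN opprB. Qed.

Lemma enorm_eq0 x : enorm x = 0 -> x = 0.
Proof.
move=> /eqP; rewrite sqrtr_eq0 => x0.
have /eqP : dotp x x = 0 by apply/eqP; rewrite eq_le x0 dotpp_ge0.
rewrite psumr_eq0; last by move=> i _; rewrite -expr2 sqr_ge0.
move=> /allP xi0; apply/rowP => i; rewrite mxE.
by have /implyP/(_ isT) := xi0 i (mem_index_enum i); rewrite mulf_eq0 orbb => /eqP.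
Qed.

Lemma dotpDD x y : dotp (x + y) (x + y) = dotp x x + dotp x y *+ 2 + dotp y y.
Proof.
rewrite /dotp -sumrMnl -!big_split/=; apply: eq_bigr => i _.
by rewrite !mxE; ring.
Qed.

Lemma dotpZBZ x y (a b : R) : dotp (a *: x - b *: y) (a *: x - b *: y) =
  a ^+ 2 * dotp x x - a * b *+ 2 * dotp x y + b ^+ 2 * dotp y y.
Proof.
rewrite /dotp !mulr_sumr -sumrN -!big_split/=; apply: eq_bigr => i _.
by rewrite !mxE; ring.
Qed.

Lemma dotp_CS x y : dotp x y ^+ 2 <= dotp x x * dotp y y.
Proof.
have [y0|y0] := eqVneq (dotp y y) 0.
  have /enorm_eq0-> : enorm y = 0 by rewrite /enorm y0 sqrtr0.
  have d0 (z : 'rV[R]_d) : dotp z 0 = 0.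
    by rewrite /dotp big1// => i _; rewrite mxE mulr0.
  by rewrite !d0 expr0n mulr0.
have ygt0 : 0 < dotp y y by rewrite lt_neqAle eq_sym y0 dotpp_ge0.
have := dotpp_ge0 (dotp y y *: x - dotp x y *: y).
rewrite dotpZBZ (_ : _ + _ = dotp y y * (dotp x x * dotp y y - dotp x y ^+ 2)).
  by rewrite pmulr_rge0// subr_ge0.
by ring.
Qed.

Lemma ler_enormD x y : enorm (x + y) <= enorm x + enorm y.
Proof.
rewrite /enorm dotpDD -(@ler_pXn2r _ 2)// ?nnegrE ?addr_ge0 ?sqrtr_ge0//.
have h : 0 <= dotp x x + dotp x y *+ 2 + dotp y y by rewrite -dotpDD dotpp_ge0.
rewrite sqrrD !sqr_sqrtr ?dotpp_ge0// lerD2r lerD2l lerMn2r/=.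
rewrite -sqrtrM ?dotpp_ge0// (le_trans (ler_norm _))// -sqrtr_sqr ler_sqrt ?dotp_CS//.
exact: mulr_ge0 (dotpp_ge0 x) (dotpp_ge0 y).
Qed.

Lemma ler_enorm_tri y x z : enorm (x - z) <= enorm (x - y) + enorm (y - z).
Proof. by rewrite (le_trans _ (ler_enormD _ _))// addrA subrK. Qed.

End euclidean.

Section law_of_cosines.
Context {R : realType}.
Implicit Types r s t a b c : R.

Let side r s a : R := Num.sqrt (r ^+ 2 + s ^+ 2 - 2 * r * s * cos a).

Let sideE r s a :
  r ^+ 2 + s ^+ 2 - 2 * r * s * cos a = (r * cos a - s) ^+ 2 + (r * sin a) ^+ 2.
Proof.
have e := cos2Dsin2 a.
transitivity (r ^+ 2 * (cos a ^+ 2 + sin a ^+ 2) + s ^+ 2 - 2 * r * s * cos a).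
  by rewrite e mulr1.
by ring.
Qed.

Lemma law_of_cosines_ge0 r s a : 0 <= r ^+ 2 + s ^+ 2 - 2 * r * s * cos a.
Proof. by rewrite sideE addr_ge0// sqr_ge0. Qed.

Let planar (u1 u2 v1 v2 : R) :
  Num.sqrt ((u1 + v1) ^+ 2 + (u2 + v2) ^+ 2) <=
  Num.sqrt (u1 ^+ 2 + u2 ^+ 2) + Num.sqrt (v1 ^+ 2 + v2 ^+ 2).
Proof.
pose u : 'rV[R]_2 := \row_i (if i == 0 then u1 else u2).
pose v : 'rV[R]_2 := \row_i (if i == 0 then v1 else v2).
have := ler_enormD u v.
by rewrite /enorm /dotp !big_ord_recl !big_ord0 !mxE/= !addr0 -!expr2.
Qed.

Let side_le r s a b : 0 <= r -> 0 <= s -> 0 <= a -> a <= b -> b <= pi ->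
  side r s a <= side r s b.
Proof.
move=> r0 s0 a0 ab bpi; rewrite ler_sqrt ?law_of_cosines_ge0//.
rewrite lerD2l lerN2 ler_wpM2l ?mulr_ge0//.
rewrite leNgt ltr_cos ?in_itv/= ?a0 ?bpi ?(le_trans a0 ab) ?(le_trans ab bpi)//.
by rewrite -leNgt.
Qed.

Lemma cone_triangle r s t a b c : 0 <= r -> 0 <= s -> 0 <= t ->
  0 <= a <= pi -> 0 <= b <= pi -> 0 <= c <= pi -> c <= a + b ->
  side r t c <= side r s a + side s t b.
Proof.
move=> r0 s0 t0 /andP[a0 api] /andP[b0 bpi] /andP[c0 cpi] cab.
pose b' := Num.min b (pi - a).
have b'0 : 0 <= b' by rewrite le_min b0 subr_ge0.
have b'b : b' <= b by rewrite ge_min lexx.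
have ab'pi : a + b' <= pi.
  by rewrite -lerBrDl ge_min lexx orbT.
have cab' : c <= a + b'.
  by rewrite -lerBlDl le_min lerBlDl cab lerD2r.
apply: (@le_trans _ _ (side r t (a + b'))); first exact: side_le.
apply: (@le_trans _ _ (side r s a + side s t b')); last first.
  by rewrite lerD2l side_le.
have -> : side r t (a + b') = Num.sqrt (((r * cos a - s) + (s - t * cos b')) ^+ 2
      + ((r * sin a) + (t * sin b')) ^+ 2).
  congr Num.sqrt; rewrite cosD.
  transitivity (r ^+ 2 * (cos a ^+ 2 + sin a ^+ 2) +
      t ^+ 2 * (cos b' ^+ 2 + sin b' ^+ 2) -
      2 * r * t * (cos a * cos b' - sin a * sin b')).
    by rewrite !cos2Dsin2 !mulr1.
  by ring.
apply: (le_trans (planar _ _ _ _)); rewrite /side sideE lerD2l.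
rewrite le_eqVlt; apply/orP; left; apply/eqP; congr Num.sqrt.
transitivity (s ^+ 2 + t ^+ 2 * (cos b' ^+ 2 + sin b' ^+ 2) -
  2 * s * t * cos b'); first by ring.
by rewrite cos2Dsin2 mulr1.
Qed.

End law_of_cosines.

Section cone.
Context {R : realType} {d : nat}.
Implicit Types p q : 'rV[R]_d * {nonneg R}.

Let cone_rel' p q := (p == q) || ((p.2%:num == 0) && (q.2%:num == 0)).

Let cone_rel_refl : reflexive cone_rel'.
Proof. by move=> p; rewrite /cone_rel' eqxx. Qed.

Let cone_rel_sym : symmetric cone_rel'.
Proof. by move=> p q; rewrite /cone_rel' eq_sym andbC. Qed.

Let cone_rel_trans : transitive cone_rel'.
Proof.
move=> q p r /predU1P[->//|/andP[p0 q0]] /predU1P[<-|/andP[_ r0]].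
  by rewrite /cone_rel' p0 q0 orbT.
by rewrite /cone_rel' p0 r0 orbT.
Qed.

Definition cone_rel := EquivRel cone_rel' cone_rel_refl cone_rel_sym cone_rel_trans.

Lemma cone_relE p q :
  cone_rel p q = (p == q) || ((p.2%:num == 0) && (q.2%:num == 0)).
Proof. by []. Qed.

End cone.

Definition cone (R : realType) (d : nat) :=
  {eq_quot (@cone_rel R d)}.

HB.instance Definition _ (R : realType) (d : nat) := Quotient.on (cone R d).
HB.instance Definition _ (R : realType) (d : nat) := Choice.on (cone R d).

Section cone_dist.
Context {R : realType} {d : nat}.
Implicit Types (p q : 'rV[R]_d * {nonneg R}) (a b c : cone R d).

Definition cone_pt (x : 'rV[R]_d) (r : {nonneg R}) : cone R d := \pi_(cone R d) (x, r).

Definition cone_vertex : cone R d := cone_pt 0 0%:nng.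

Definition cone_rad a : R := (repr a).2%:num.

(* Only meaningful off the vertex, where it does not depend on the
   representative; at the vertex it is an arbitrary fixed point. *)
Definition cone_pos a : 'rV[R]_d := (repr a).1.

Definition cone_dist a b : R :=
  Num.sqrt (cone_rad a ^+ 2 + cone_rad b ^+ 2 - 2 * cone_rad a * cone_rad b *
            cos (Num.min (enorm (cone_pos a - cone_pos b)) pi)).

Lemma cone_rad_ge0 a : 0 <= cone_rad a.
Proof. by rewrite /cone_rad. Qed.

Lemma cone_ptP x r : let a := cone_pt x r in
  cone_rad a = r%:num /\ (r%:num != 0 -> cone_pos a = x).
Proof.
have /eqmodP : repr (cone_pt x r) = (x, r) %[mod cone R d] by rewrite reprK.
rewrite cone_relE /cone_rad /cone_pos => /predU1P[->//|/= /andP[/eqP-> /eqP->]].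
by rewrite eqxx.
Qed.

Lemma cone_rad_pt x r : cone_rad (cone_pt x r) = r%:num.
Proof. by case: (cone_ptP x r). Qed.

Lemma cone_pos_pt x r : r%:num != 0 -> cone_pos (cone_pt x r) = x.
Proof. by case: (cone_ptP x r). Qed.

Lemma cone_pt_vertex x : cone_pt x 0%:nng = cone_vertex.
Proof. by apply/eqmodP; rewrite cone_relE/= eqxx orbT. Qed.

Lemma cone_distE (x0 x1 : 'rV[R]_d) (r0 r1 : {nonneg R}) :
  cone_dist (cone_pt x0 r0) (cone_pt x1 r1) =
  Num.sqrt (r0%:num ^+ 2 + r1%:num ^+ 2 - 2 * r0%:num * r1%:num *
            cos (Num.min (enorm (x0 - x1)) pi)).
Proof.
rewrite /cone_dist !cone_rad_pt.
have [->|r0N0] := eqVneq r0%:num 0; first by rewrite !mulr0 !mul0r.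
have [->|r1N0] := eqVneq r1%:num 0; first by rewrite !mulr0 !mul0r.
by rewrite !cone_pos_pt.
Qed.

Lemma cone_eqP a b : a = b <-> cone_rad a = cone_rad b /\
  (cone_rad a != 0 -> cone_pos a = cone_pos b).
Proof.
split=> [->//|[rab xab]]; rewrite -[LHS]reprK -[RHS]reprK.
move: rab xab; rewrite /cone_rad /cone_pos => rab xab; apply/eqmodP; rewrite cone_relE.
have [r0|r0] := eqVneq (repr a).2%:num 0; first by rewrite -rab r0 eqxx orbT.
apply/orP; left; apply/eqP; move: (xab r0) rab.
by case: (repr a) => xa ra; case: (repr b) => xb rb /= -> /val_inj ->.
Qed.

Let angle_itv (x : 'rV[R]_d) : 0 <= Num.min (enorm x) pi <= pi.
Proof. by rewrite le_min enorm_ge0 pi_ge0/= ge_min lexx orbT. Qed.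

Lemma cone_distxx a : cone_dist a a = 0.
Proof.
rewrite /cone_dist subrr enorm0 (_ : Num.min 0 pi = 0); last first.
  by apply/min_idPl; exact: pi_ge0.
by rewrite cos0 (_ : _ - _ = 0) ?sqrtr0//; ring.
Qed.

Lemma cone_dist_sym a b : cone_dist a b = cone_dist b a.
Proof. by rewrite /cone_dist enorm_distC; congr Num.sqrt; ring. Qed.

Lemma cone_dist_triangle b a c : cone_dist a c <= cone_dist a b + cone_dist b c.
Proof.
apply: cone_triangle; rewrite ?cone_rad_ge0 ?angle_itv//.
have := ler_enorm_tri (cone_pos b) (cone_pos a) (cone_pos c).
have := enorm_ge0 (cone_pos a - cone_pos b).
have := enorm_ge0 (cone_pos b - cone_pos c).
have := pi_ge0 R.
move: (pi : R) => p p0 h1 h2 h3.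
rewrite !minEle; case: (leP (enorm (cone_pos a - cone_pos c))) => h4;
  case: (leP (enorm (cone_pos a - cone_pos b))) => h5;
  case: (leP (enorm (cone_pos b - cone_pos c))) => h6; lra.
Qed.

Lemma cone_dist_eq0 a b : cone_dist a b = 0 -> a = b.
Proof.
move=> /eqP; rewrite sqrtr_eq0.
set th := Num.min _ _; set r := cone_rad a; set s := cone_rad b.
have [r0 s0] : 0 <= r /\ 0 <= s by split; exact: cone_rad_ge0.
have -> : r ^+ 2 + s ^+ 2 - 2 * r * s * cos th =
  (r - s) ^+ 2 + 2 * (r * s * (1 - cos th)) by ring.
have h1 := sqr_ge0 (r - s).
have h2 : 0 <= r * s * (1 - cos th).
  by rewrite mulr_ge0 ?mulr_ge0// subr_ge0 cos_le1.
move=> h.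
have rs : r = s.
  by apply/eqP; rewrite -subr_eq0 -sqrf_eq0 eq_le h1 andbT; lra.
apply/cone_eqP; split=> // rN0.
have : r * s * (1 - cos th) = 0 by apply/eqP; rewrite eq_le h2 andbT; lra.
move=> /eqP; rewrite -rs !mulf_eq0 (negbTE rN0)/= subr_eq0 -(@cos0 R).
move=> /eqP/cos_inj th0.
have := angle_itv (cone_pos a - cone_pos b).
rewrite -/th => thpi.
have {}th0 : th = 0 by rewrite th0 ?in_itv//= lexx pi_ge0.
apply/eqP; rewrite -subr_eq0; apply/eqP/enorm_eq0.
move: th0; rewrite /th /Num.min; case: ltP => // _ /eqP.
by rewrite gt_eqF// pi_gt0.
Qed.

HB.instance Definition _ := @isMetric.Build R (cone R d) cone_dist
  cone_distxx cone_dist_eq0 cone_dist_sym cone_dist_triangle.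
HB.instance Definition _ := isPointed.Build (cone R d) cone_vertex.

Lemma cone_mdistE a b : mdist a b = cone_dist a b.
Proof. by []. Qed.

Lemma cone_rad_lip a b : `|cone_rad a - cone_rad b| <= mdist a b.
Proof.
rewrite cone_mdistE -sqrtr_sqr ler_sqrt ?law_of_cosines_ge0//.
set r := cone_rad a; set s := cone_rad b; set c := cos _.
have : 0 <= r * s * (1 - c).
  by rewrite mulr_ge0 ?subr_ge0 ?cos_le1// mulr_ge0// cone_rad_ge0.
by move=> h; rewrite -subr_ge0 (_ : _ - _ = 2 * (r * s * (1 - c))); [lra|ring].
Qed.

End cone_dist.


Lemma continuous_at_ball (R : realType) (M N : pseudoMetricType R) (f : M -> N) a :
  (forall e, 0 < e -> exists2 del, 0 < del & ball a del `<=` f @^-1` ball (f a) e) ->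
  {for a, continuous f}.
Proof.
move=> h; apply/cvg_ballP => e /h[del del0 hdel].
by apply/nbhs_ballP; exists del.
Qed.

Section cone_continuity.
Context {R : realType} {d : nat}.
Implicit Types a b : cone R d.

Lemma cone_rad_continuous : continuous (@cone_rad R d).
Proof.
move=> a; apply: continuous_at_ball => e e0; exists e => // b.
rewrite ballEmdist; exact: le_lt_trans (cone_rad_lip _ _).
Qed.

Lemma coord_le_enorm (x : 'rV[R]_d) i : `|x 0 i| <= enorm x.
Proof.
rewrite -sqrtr_sqr ler_sqrt ?dotpp_ge0// /dotp (bigD1 i)//= expr2 lerDl.
by apply: sumr_ge0 => j _; rewrite -expr2 sqr_ge0.
Qed.

Lemma cone_pos_continuous a : 0 < cone_rad a ->
  {for a, continuous (@cone_pos R d)}.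
Proof.
move=> ra; apply: continuous_at_ball => e e0.
pose e' := Num.min e pi.
have e'0 : 0 < e' by rewrite lt_min e0 pi_gt0.
have e'pi : e' <= pi by rewrite ge_min lexx orbT.
set r := cone_rad a in ra.
have ce' : 0 < 1 - cos e'.
  rewrite subr_gt0 -(@cos0 R) ltr_cos// ?in_itv/= ?lexx ?pi_ge0//.
  by rewrite (ltW e'0).
pose c := 1 - cos e'.
have rc0 : 0 < r ^+ 2 * c by rewrite mulr_gt0// exprn_gt0.
pose del := Num.min (r / 2) (Num.sqrt (r ^+ 2 * c)).
have del0 : 0 < del by rewrite lt_min divr_gt0//= sqrtr_gt0.
exists del => // b; rewrite ballEmdist/= => ab; split=> [//|i j].
rewrite ord1 /ball/=.
apply: (le_lt_trans (y := enorm (cone_pos a - cone_pos b))).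
  by have := coord_le_enorm (cone_pos a - cone_pos b) j; rewrite !mxE.
set s := cone_rad b; set x := enorm _.
have rs : `|r - s| < r / 2.
  by apply: (le_lt_trans (cone_rad_lip _ _)); move: ab; rewrite lt_min => /andP[].
have s2 : r / 2 < s by move: rs; rewrite ltr_norml => /andP[]; lra.
have : mdist a b < Num.sqrt (r ^+ 2 * c) by move: ab; rewrite lt_min => /andP[].
rewrite cone_mdistE ltr_sqrt// -/r -/s -/x => h.
rewrite ltNge; apply/negP => ex.
have e'x : e' <= Num.min x pi.
  by rewrite le_min e'pi andbT (le_trans _ ex)// ge_min lexx.
have cc : cos (Num.min x pi) <= cos e'.
  rewrite leNgt ltr_cos ?in_itv/= ?(ltW e'0) ?e'pi// -?leNgt//.
  by rewrite (le_trans (ltW e'0) e'x) ge_min lexx orbT.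
have h2 : r * s * c <= r * s * (1 - cos (Num.min x pi)).
  by rewrite ler_wpM2l ?mulr_ge0 ?lerD2l ?lerN2//; lra.
have h3 : r ^+ 2 * c <= 2 * (r * s * c).
  rewrite -subr_ge0 (_ : _ - _ = r * (2 * s - r) * c); last by ring.
  by rewrite !mulr_ge0 /c//; lra.
have h4 := sqr_ge0 (r - s).
have : r ^+ 2 + s ^+ 2 - 2 * r * s * cos (Num.min x pi) =
  (r - s) ^+ 2 + 2 * (r * s * (1 - cos (Num.min x pi))) by ring.
lra.
Qed.

Lemma cone_dist_vertex a : mdist a (cone_vertex : cone R d) = cone_rad a.
Proof.
rewrite cone_mdistE /cone_dist (_ : cone_rad cone_vertex = 0) ?cone_rad_pt//.
by rewrite !mulr0 mul0r subr0 expr0n addr0 sqrtr_sqr ger0_norm// cone_rad_ge0.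
Qed.

End cone_continuity.

Definition cone_curve (R : realType) (d : nat) (T : R) : Type :=
  continuousType (set_type `[0, T]%classic) (cone R d).

HB.instance Definition _ (R : realType) (d : nat) (T : R) :=
  Choice.on (cone_curve d T).

Section cone_curve.
Context {R : realType} {d : nat} {T : R}.
Implicit Types g h k : cone_curve d T.

Definition cone_curve_fun g : set_type `[0, T]%classic -> cone R d :=
  Continuous.sort g.

(* Evaluation at real times: [g] extended by the vertex outside [0, T]. *)
Definition curve_at g : R -> cone R d := 'valL_cone_vertex (cone_curve_fun g).

Definition xcurve g (t : R) : 'rV[R]_d := cone_pos (curve_at g t).
Definition rcurve g (t : R) : R := cone_rad (curve_at g t).

Lemma curve_at_within g : {within `[0, T], continuous (curve_at g)}.
Proof. exact/subspace_valL_continuousP'/(@cts_fun _ _ g). Qed.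

Lemma curve_at_val g (s : set_type `[0, T]%classic) :
  curve_at g (set_val s) = cone_curve_fun g s.
Proof. by rewrite -[in RHS](@valLK _ _ cone_vertex _ (cone_curve_fun g)). Qed.

Lemma curve_at_out g t : t \notin `[0, T] -> curve_at g t = cone_vertex.
Proof.
move=> tN; rewrite /curve_at /valL_ /= oinv_set_val insubN//=.
by rewrite notin_setE/=; apply/negP.
Qed.

Definition curve_dist g h : R :=
  sup [set mdist (cone_curve_fun g s) (cone_curve_fun h s) | s in setT].

Lemma rcurve_bounded g : exists M, forall s, cone_rad (cone_curve_fun g s) <= M.
Proof.
have [T0|T0] := leP 0 T; last first.
  exists 0 => -[s si]; exfalso; move: si; rewrite inE/= in_itv/= => /andP[s0 sT].
  by move: (le_trans s0 sT); rewrite leNgt T0.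
have [|c _ cmax] := @EVT_max R (rcurve g) 0 T T0.
  move=> t; apply: continuous_comp; first exact: curve_at_within.
  exact: cone_rad_continuous.
exists (rcurve g c) => s; rewrite -curve_at_val; apply: cmax.
by have := set_valP s.
Qed.

Let S g h := [set mdist (cone_curve_fun g s) (cone_curve_fun h s) | s in setT].

Let S_ub g h : has_ubound (S g h).
Proof.
have [M gM] := rcurve_bounded g; have [N hN] := rcurve_bounded h.
exists (M + N) => _ [s _ <-].
apply: (le_trans (cone_dist_triangle cone_vertex _ _)).
rewrite lerD// -?cone_mdistE; last rewrite metric_sym; by rewrite cone_dist_vertex.
Qed.

Lemma curve_dist_le g h s :
  mdist (cone_curve_fun g s) (cone_curve_fun h s) <= curve_dist g h.
Proof. by apply: ub_le_sup; [exact: S_ub|exists s]. Qed.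

Lemma curve_dist_ge0 g h : 0 <= curve_dist g h.
Proof.
have [S0|/set0P[_ [s _ _]]] := eqVneq (S g h) set0.
  by rewrite /curve_dist -/(S g h) S0 sup0.
exact: le_trans (mdist_ge0 _ _) (curve_dist_le g h s).
Qed.

Lemma curve_dist_leP g h (M : R) : 0 <= M ->
  (forall s, mdist (cone_curve_fun g s) (cone_curve_fun h s) <= M) ->
  curve_dist g h <= M.
Proof.
move=> M0 gh; rewrite /curve_dist -/(S g h); have [->|S0] := eqVneq (S g h) set0.
  by rewrite sup0.
by apply: ge_sup; [exact/set0P|move=> _ [s _ <-]].
Qed.

Lemma curve_distxx g : curve_dist g g = 0.
Proof.
apply/eqP; rewrite eq_le curve_dist_ge0 curve_dist_leP// => s.
by rewrite cone_mdistE cone_distxx.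
Qed.

Lemma curve_dist_eq0 g h : curve_dist g h = 0 -> g = h.
Proof.
move=> gh; apply/continuousEP => s; apply: cone_dist_eq0; apply/eqP.
rewrite eq_le sqrtr_ge0 andbT -cone_mdistE.
by apply: (le_trans (curve_dist_le g h s)); rewrite gh.
Qed.

Lemma curve_dist_sym g h : curve_dist g h = curve_dist h g.
Proof.
by rewrite /curve_dist; congr sup; apply: eq_imagel => s _; rewrite metric_sym.
Qed.

Lemma curve_dist_triangle h g k :
  curve_dist g k <= curve_dist g h + curve_dist h k.
Proof.
apply: curve_dist_leP => [|s]; first by rewrite addr_ge0 ?curve_dist_ge0.
apply: (le_trans (cone_dist_triangle (cone_curve_fun h s) _ _)).
by rewrite lerD// -cone_mdistE curve_dist_le.
Qed.

HB.instance Definition _ := @isMetric.Build R (cone_curve d T) curve_dist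
  curve_distxx curve_dist_eq0 curve_dist_sym curve_dist_triangle.

HB.instance Definition _ := isPointed.Build (cone_curve d T)
  (cst cone_vertex : continuousType _ _).

Lemma curve_mdistE g h : mdist g h = curve_dist g h.
Proof. by []. Qed.

Lemma curve_at_dist_le g h t : mdist (curve_at g t) (curve_at h t) <= mdist g h.
Proof.
have [t0|t0] := boolP (t \in `[0, T]); last first.
  by rewrite !curve_at_out// cone_mdistE cone_distxx curve_dist_ge0.
have tA : t \in `[0, T]%classic by rewrite inE.
have -> : t = set_val (exist _ t tA : set_type `[0, T]%classic) by [].
by rewrite !curve_at_val; exact: curve_dist_le.
Qed.

Lemma curve_at_continuous t : continuous (fun g => curve_at g t).
Proof.
move=> g; apply: continuous_at_ball => e e0; exists e => //= h.
by rewrite !ballEmdist/=; exact: le_lt_trans (curve_at_dist_le _ _ _).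
Qed.

End cone_curve.

HB.instance Definition _ (R : realType) (m n : nat) :=
  Measurable.copy 'M[R]_(m, n) (g_sigma_algebraType (@open 'M[R]_(m, n))).
HB.instance Definition _ (R : realType) (d : nat) (T : R) :=
  Measurable.copy (cone_curve d T) (g_sigma_algebraType (@open (cone_curve d T))).


Section curve_measurability.
Context {R : realType} {d : nat} {T : R}.
Implicit Types g : cone_curve d T.

Lemma open_curve_measurable (U : set (cone_curve d T)) : open U -> measurable U.
Proof. exact: sub_sigma_algebra. Qed.

Lemma measurable_rcurve t :
  measurable_fun [set: cone_curve d T] (fun g => rcurve g t : R).
Proof.
apply: (measurability _ (measurable_realfun.RGenOInfty.measurableE R)) => // _ [_ [a ->] <-].
rewrite setTI; apply: open_curve_measurable; apply: open_comp => //= g _.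
apply: continuous_comp; first exact: curve_at_continuous.
exact: cone_rad_continuous.
Qed.

Lemma xcurve_vertex g t : rcurve g t = 0 -> xcurve g t = cone_pos cone_vertex.
Proof.
move=> r0; congr cone_pos; apply/cone_eqP.
by rewrite -/(rcurve g t) r0 cone_rad_pt eqxx.
Qed.

Lemma measurable_xcurve t :
  measurable_fun [set: cone_curve d T] (fun g => xcurve g t).
Proof.
pose E := [set g : cone_curve d T | 0 < rcurve g t].
have oE : open E.
  rewrite (_ : E = (fun g => rcurve g t) @^-1` `]0, +oo[); last first.
    by apply/seteqP; split => g; rewrite /E/= in_itv/= andbT.
  apply: open_comp => // g _.
  apply: continuous_comp; first exact: curve_at_continuous.
  exact: cone_rad_continuous.
have mE : measurable E by exact: open_curve_measurable.
rewrite -(setUv E).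
apply/(measurable_funU _ mE (measurableC mE)).
split; last first.
  apply: (eq_measurable_fun (cst (cone_pos (cone_vertex : cone R d)))) => //.
  move=> g; rewrite inE /E/= => /negP; rewrite -leNgt => r0.
  by rewrite xcurve_vertex//; apply/eqP; rewrite eq_le r0 cone_rad_ge0.
move=> _ Y; apply: (@measurability _ _ _ _ E _ (@open 'rV[R]_d)) => //.
move=> _ [U oU <-]; apply: open_curve_measurable.
apply/interior_id/seteqP; split; first exact: interior_subset.
move=> g [Eg Ug]; rewrite /interior.
apply: filterI; first exact: open_nbhs_nbhs.
have cg : {for g, continuous (fun g => xcurve g t)}.
  apply: continuous_comp; first exact: curve_at_continuous.
  exact: cone_pos_continuous.
by apply: cg; exact: open_nbhs_nbhs.
Qed.

End curve_measurability.

Section h2.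
Context {R : realType} {d : nat} {T : R}.
Variable eta : {measure set (cone_curve d T) -> \bar R}.
Variable t : R.
Local Open Scope ereal_scope.

(* The defining identity for arbitrary non-negative Borel integrands is
   [integral_h2] below. *)
Definition h2 (A : set 'rV[R]_d) : \bar R :=
  \int[eta]_g ((\1_A (xcurve g t) * rcurve g t ^+ 2)%R)%:E.

Let mr2 : measurable_fun [set: cone_curve d T]
  (fun g => (rcurve g t ^+ 2)%:E : \bar R).
Proof. by apply/measurable_EFinP/measurable_funX; exact: measurable_rcurve. Qed.

Let h2E A : measurable A ->
  h2 A = \int[eta]_(g in (fun g => xcurve g t) @^-1` A) (rcurve g t ^+ 2)%:E.
Proof.
move=> mA; rewrite [RHS]integral_mkcond; apply: eq_integral => g _.
rewrite /patch /= indicE.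
have -> : (g \in (fun g => xcurve g t) @^-1` A) = (xcurve g t \in A).
  by apply/idP/idP; rewrite !inE.
by case: ifP => _; rewrite ?mul1r ?mul0r.
Qed.

Let h20 : h2 set0 = 0.
Proof. by rewrite h2E// preimage_set0 integral_set0. Qed.

Let h2_ge0 A : 0 <= h2 A.
Proof. by apply: integral_ge0 => g _; rewrite lee_fin mulr_ge0// sqr_ge0. Qed.

Let h2_sigma_additive : semi_sigma_additive h2.
Proof.
move=> F mF tF mUF; rewrite h2E//.
have mX A : measurable A ->
    measurable ((fun g : cone_curve d T => xcurve g t) @^-1` A).
  by move=> mA; rewrite -[X in measurable X]setTI; exact: measurable_xcurve.
rewrite preimage_bigcup ge0_integral_bigcup//=; last 4 first.
- by move=> k; exact: mX.
- exact: measurable_funTS.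
- by move=> g _; rewrite lee_fin sqr_ge0.
- by move=> i j _ _ [g [/= gi gj]]; apply: (tF i j) => //; exists (xcurve g t).
under eq_fun do under eq_bigr do rewrite h2E//.
by apply: is_cvg_ereal_nneg_natsum_cond => // n _ _; apply: integral_ge0 => g _;
  rewrite lee_fin sqr_ge0.
Qed.

HB.instance Definition _ := isMeasure.Build _ _ _ h2 h20 h2_ge0 h2_sigma_additive.

Let mind (A : set 'rV[R]_d) : measurable A ->
  measurable_fun [set: cone_curve d T]
    (fun g => (\1_A (xcurve g t) * rcurve g t ^+ 2)%:E : \bar R).
Proof.
move=> mA; apply/measurable_EFinP/measurable_funM.
  apply: (measurableT_comp (f := \1_A : 'rV[R]_d -> R)); first exact: measurable_indic.
  exact: measurable_xcurve.
by apply/measurable_funX; exact: measurable_rcurve.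
Qed.

Import HBNNSimple.

Let h2_nnsfun (f : {nnsfun 'rV[R]_d >-> R}) :
  \int[h2]_x (f x)%:E = \int[eta]_g (f (xcurve g t) * rcurve g t ^+ 2)%:E.
Proof.
under [in LHS]eq_integral do rewrite fimfunE -fsumEFin//.
rewrite ge0_integral_fsum//; last 2 first.
  - by move=> r; exact/measurable_EFinP/measurableT_comp.
  - by move=> r z _; rewrite EFinM nnfun_muleindic_ge0.
under [in RHS]eq_integral => g _.
  rewrite fimfunE EFinM -fsumEFin// ge0_mule_fsuml; last first.
    by move=> r; rewrite EFinM nnfun_muleindic_ge0.
  over.
rewrite ge0_integral_fsum//; last 2 first.
  - move=> r; apply: emeasurable_funM.
      apply/measurable_EFinP/measurable_funM => //.
      apply: (measurableT_comp (f := \1_(f @^-1` [set r]) : 'rV[R]_d -> R)) => //.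
      exact: measurable_xcurve.
    exact: mr2.
  - move=> r g _; apply: mule_ge0; first by rewrite EFinM nnfun_muleindic_ge0.
    by rewrite lee_fin sqr_ge0.
apply: eq_fsbigr => r _.
rewrite (integralZl_indic _ (fun r => f @^-1` [set r]))//; last first.
  by move=> r0; rewrite preimage_nnfun0.
rewrite integral_indic// setIT.
have [r0|r0] := leP 0%R r.
  rewrite /= -ge0_integralZl//; last 2 first.
    - exact: mind.
    - by move=> g _; rewrite lee_fin mulr_ge0// sqr_ge0.
  by apply: eq_integral => g _; rewrite -!EFinM mulrA.
rewrite preimage_nnfun0// measure0 mule0 integral0_eq// => g _.
by rewrite indic0 mulr0 mul0e.
Qed.

Lemma integral_h2 (phi : 'rV[R]_d -> \bar R) :
  (forall x, 0 <= phi x) -> measurable_fun [set: 'rV[R]_d] phi ->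
  \int[h2]_x phi x = \int[eta]_g (phi (xcurve g t) * (rcurve g t ^+ 2)%:E).
Proof.
move=> f0 mf; pose f_ := nnsfun_approx measurableT mf.
have cf x : (f_ n x)%:E @[n --> \oo] --> phi x by exact: cvg_nnsfun_approx.
transitivity (\int[h2]_x (lim ((f_ n x)%:E @[n --> \oo]))).
  by apply/eq_integral => x _; apply/esym/cvg_lim => //; exact: cf.
rewrite monotone_convergence//; last 3 first.
  by move=> n; exact/measurable_EFinP.
  by move=> n z _; rewrite lee_fin.
  by move=> z _ a b ab; rewrite lee_fin; exact/lefP/nd_nnsfun_approx.
under eq_fun do rewrite h2_nnsfun.
rewrite -monotone_convergence//; last 3 first.
- move=> n; apply/measurable_EFinP/measurable_funM.
    apply: (measurableT_comp (f := f_ n : 'rV[R]_d -> R)) => //.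
    exact: measurable_xcurve.
  by apply/measurable_funX; exact: measurable_rcurve.
- by move=> n g _; rewrite lee_fin mulr_ge0// sqr_ge0.
- move=> g _ a b ab; rewrite lee_fin ler_wpM2r ?sqr_ge0//.
  exact/lefP/nd_nnsfun_approx.
apply: eq_integral => g _; apply/cvg_lim => //.
under eq_fun do rewrite EFinM.
by apply: cvgeZr => //; exact: cf.
Qed.

End h2.

Section metric_curves.
Context {R : realType} {M : metricType R}.
Local Notation leb := (@lebesgue_measure R).

(* Absolute continuity in a metric space: the increments are controlled by the
   integral of a function in L^1(0, T). *)
Definition abs_continuous (T : R) (c : R -> M) : Prop :=
  exists2 f : R -> R, leb.-integrable `[0, T] (EFin \o f) &
    forall s t, 0 <= s -> s <= t -> t <= T ->
      ((mdist (c s) (c t))%:E <= \int[leb]_(u in `[s, t]) (f u)%:E)%E.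

Definition has_metric_derivative (c : R -> M) (t m : R) : Prop :=
  mdist (c (t + h)) (c t) / `|h| @[h --> 0^'] --> m.

Definition AC2 (T : R) (c : R -> M) : Prop :=
  abs_continuous T c /\
  exists m : R -> R,
    [/\ measurable_fun (`[0, T]%classic : set R) m,
        (\int[leb]_(t in `[0%R, T]) (m t ^+ 2)%:E < +oo)%E &
        {ae leb, forall t, t \in `]0, T[ -> has_metric_derivative c t (m t)}].

End metric_curves.

Section reaction_continuity.
Context {R : realType} {d : nat}.
Variables (T : R) (v : R -> 'rV[R]_d -> 'rV[R]_d) (w : R -> 'rV[R]_d -> R).
Local Notation leb := (@lebesgue_measure R).

(* At a time t in (0, T) with 0 < rcurve g t, the radius stays positive near t,
   so the derivative of [xcurve g] does not see the conventional value of
   [cone_pos] at the vertex. *)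
Definition characteristic (g : cone_curve d T) : Prop :=
  {ae leb, forall t, t \in `[0, T] -> 0 < rcurve g t ->
     is_derive t 1 (xcurve g) (v t (xcurve g t)) /\
     is_derive t 1 (fun s => rcurve g s ^+ 2)
       (w t (xcurve g t) * rcurve g t ^+ 2)}.

Definition narrowly_continuous (mu : R -> {measure set 'rV[R]_d -> \bar R}) :
    Prop :=
  (forall t, t \in `[0, T] -> (mu t setT < +oo)%E) /\
  (forall phi : 'rV[R]_d -> R, continuous phi ->
     (exists C : R, forall x, `|phi x| <= C) ->
     {within `[0, T], continuous (fun t => \int[mu t]_x phi x)}).

Fixpoint continuously_differentiable (V : normedModType R) (n : nat)
    (f : V -> R) : Prop :=
  continuous f /\
  if n is n'.+1 then
    forall u : V, (forall x, derivable f x u) /\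
      continuously_differentiable n' (fun x => 'D_u f x)
  else True.

(* Elements of C_c^oo((0, T) x R^d), extended by zero to R x R^d. *)
Definition test_function (zeta : R * 'rV[R]_d -> R) : Prop :=
  let supp := closure [set p | zeta p != 0] in
  [/\ forall n, continuously_differentiable n zeta,
      compact supp & supp `<=` `]0, T[ `*` setT].

Definition time_derivative (zeta : R * 'rV[R]_d -> R) (t : R) (x : 'rV[R]_d) : R :=
  derive1 (fun s => zeta (s, x)) t.

Definition space_gradient (zeta : R * 'rV[R]_d -> R) (t : R) (x : 'rV[R]_d) :
    'rV[R]_d :=
  \row_i 'D_(delta_mx 0 i) (fun y => zeta (t, y)) x.

Definition reaction_continuity_equation
    (mu : R -> {measure set 'rV[R]_d -> \bar R}) : Prop :=
  forall zeta, test_function zeta ->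
    (\int[leb]_(t in `[0%R, T]) \int[mu t]_x
      (time_derivative zeta t x + dotp (space_gradient zeta t x) (v t x) +
       zeta (t, x) * w t x)%:E = 0)%E.

End reaction_continuity.

(* Main.v *)
Require Import Defs.
From HB Require Import structures.
From mathcomp Require Import all_boot all_order all_algebra generic_quotient.
From mathcomp Require Import all_classical all_reals all_analysis.
From mathcomp Require Import measurable_realfun.
From mathcomp Require Import ring lra.

Import Order.TTheory GRing.Theory Num.Theory.
Import numFieldTopology.Exports numFieldNormedType.Exports.

(** Write [k = r^2] for the squared radius of a curve [[x, r]] in the cone. The
    measures [mu_t = h2 eta t] are superpositions of the weighted points
    [k(t) delta_{x(t)}], and both claims are proved first for a single curve and
    then integrated against [eta].

    Along one curve, let [zeta] be a test function, or the constant [1], and let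
    [F(t) = zeta(t, x(t)) k(t)]. The position [x] has no meaning at the vertex and
    may oscillate wildly near it, but [F] does not see this: on bounded sets of the
    cone, [(t, [x, r]) |-> zeta(t, x) r^2] is Lipschitz for the cone distance
    ([cone_observable_lipschitz]). So [F] is absolutely continuous because the
    curve is. For almost every time its derivative is
    [(d_t zeta + <grad zeta, v> + zeta w) k]: this is the product rule where
    [r > 0], and where [r = 0] both sides vanish, since [|F| <= C r^2] and [r]
    grows at most linearly away from almost every one of its zeros
    ([observable_derivative]). Lebesgue's fundamental theorem of calculus then
    gives the increments of [F] ([observable_FTC]).

    This theorem is proved by applying Fatou's lemma to difference quotients: a
    continuous nondecreasing [M] satisfies [\int M' <= M(b) - M(a)]
    ([nondecreasing_integral_derive_le]). If the increments of [F] are bounded by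
    those of the primitive [P] of an integrable function, then [P + F] and [P - F]
    are nondecreasing, and the two inequalities together give equality for [F]
    ([absolutely_continuous_FTC]).

    For [zeta = 1] the increments of [k] are at most [\int |w| k], and averaging
    over the starting time bounds [k] uniformly in time by a multiple of
    [\int_0^T (1 + |v| + |w|) k dt] ([rcurve_sqr_le_action]). By assumption the
    latter is integrable over the curves, so the [mu_t] are finite measures and
    dominated convergence gives narrow continuity. For [zeta] a test function, [F]
    vanishes at both ends of [[0, T]], so the time integral of its derivative is
    [0] for almost every curve; integrating over the curves and exchanging the
    integrals gives the equation. Fubini's theorem requires [x] and [r] to be
    jointly measurable in the time and the curve, which holds because they are
    measurable in the curve and governed by a path that is continuous in time
    ([caratheodory_measurable_preimage]). *)

Set Implicit Arguments.
Unset Strict Implicit.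
Unset Printing Implicit Defensive.

Local Open Scope classical_set_scope.
Local Open Scope ring_scope.

(** * The fundamental theorem of calculus for absolutely continuous functions *)

Section almost_everywhere.
Context d (X : measurableType d) (R : realType) (mu : {measure set X -> \bar R}).
Implicit Types P Q S : X -> Prop.

Lemma ae_imply P Q : {ae mu, forall x, P x} -> (forall x, P x -> Q x) ->
  {ae mu, forall x, Q x}.
Proof.
by move=> aeP PQ; exact: (@filterS _ _ (ae_filter_ringOfSetsType mu) _ _ PQ).
Qed.

Lemma ae_imply2 P Q S : {ae mu, forall x, P x} -> {ae mu, forall x, Q x} ->
  (forall x, P x -> Q x -> S x) -> {ae mu, forall x, S x}.
Proof.
by move=> aeP aeQ PQ; exact: (@filterS2 _ _ (ae_filter_ringOfSetsType mu) _ _ _ PQ).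
Qed.

End almost_everywhere.

Section monotone_and_dominated.
Context {R : realType}.
Local Notation leb := (@lebesgue_measure R).
Implicit Types (F M P : R -> R) (a b t : R).

Lemma is_derive_diffquot F t (df : R) : is_derive t 1 F df ->
  (F (t + @harmonic R n) - F t) / @harmonic R n @[n --> \oo] --> df.
Proof.
move=> [dF /= <-].
have qF : h^-1 *: (F (h *: 1 + t) - F t) @[h --> 0^'] --> 'D_1 F t by [].
have /(@cvg_at_rightP R (fun h => h^-1 *: (F (h *: 1 + t) - F t))) :=
  cvg_dnbhs_at_right qF.
have h0 n : 0 < @harmonic R n by rewrite harmonic_gt0.
move=> /(_ _ (conj h0 (@cvg_harmonic R))).
apply: cvg_trans; apply: near_eq_cvg; apply: nearW => n /=.
by rewrite [in RHS]mulrC/= -[n.+1%:R^-1 *: 1]/(n.+1%:R^-1 * 1) mulr1 (addrC t).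
Qed.

Lemma diffquot_ge0 M t n : {homo M : s t / s <= t} ->
  0 <= (M (t + @harmonic R n) - M t) / @harmonic R n.
Proof.
by move=> ndM; rewrite divr_ge0 ?harmonic_ge0// subr_ge0 ndM// lerDl harmonic_ge0.
Qed.

Lemma nondecreasing_is_derive_ge0 M t (m : R) : {homo M : s t / s <= t} ->
  is_derive t 1 M m -> 0 <= m.
Proof.
move=> ndM /is_derive_diffquot qm; rewrite -(cvg_lim _ qm)//.
apply: limr_ge; first by apply/cvg_ex; exists m.
by apply: nearW => n; exact: diffquot_ge0.
Qed.

(** With [Q] a primitive of [M], the difference quotient of [M] is the derivative
    of the difference quotient of [Q], so its integral over [[a, b]] is the
    difference of the quotients of [Q] at [b] and at [a]. *)
Lemma cvg_integral_diffquot M a b : a < b -> continuous M ->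
  (\int[leb]_(t in `[a, b])
     ((M (t + @harmonic R n) - M t) / @harmonic R n)%:E)%E @[n --> \oo]
  --> (M b - M a)%:E.
Proof.
move=> ab cM.
(* The base point lies to the left of [a] so that [Q' = M] also holds at [a]. *)
pose Q (x : R) := (\int[leb]_(t in `[(a - 1)%R, x]) M t)%R.
have dQ (x : R) : a - 1 < x -> is_derive x 1 Q (M x).
  move=> ax; have xx1 : x < x + 1 by rewrite ltrDl.
  have iM : leb.-integrable `[a - 1, x + 1] (EFin \o M).
    apply: continuous_compact_integrable; first exact: segment_compact.
    by apply: continuous_subspaceT => ?; exact: cM.
  have dQ := continuous_FTC1_closed xx1 iM ax (cM x).
  by split; [exact: dQ.1|rewrite -derive1E; exact: dQ.2].
pose h n : R := @harmonic R n.
have h0 n : 0 < h n by rewrite /h harmonic_gt0.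
pose G n (x : R) : R := (h n)^-1 *: (Q (x + h n) - Q x).
have dG n (x : R) : a - 1 < x -> is_derive x 1 (G n) ((M (x + h n) - M x) / h n).
  move=> ax; rewrite mulrC; apply: is_deriveZ; apply: is_deriveB; last exact: dQ.
  have dQx : is_derive (x + h n) 1 Q (M (x + h n)).
    by apply: dQ; rewrite (lt_trans ax)// ltrDl.
  have := @is_derive1_comp R Q (fun x => x + h n) x (M (x + h n)) 1.
  rewrite mulr1; apply => //.
  by rewrite -[X in is_derive _ _ _ X]addr0; exact: is_deriveD.
have intE n : (\int[leb]_(t in `[a, b])
    ((M (t + @harmonic R n) - M t) / @harmonic R n)%:E)%E = (G n b - G n a)%:E.
  rewrite (@continuous_FTC2 _ _ (G n))//; last 3 first.
  - apply: continuous_subspaceT => x; apply: cvgMl; apply: cvgB; last exact: cM.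
    apply: (@cvg_comp _ _ _ (fun x => x + h n) M _ (nbhs (x + h n))).
      by apply: cvgD; [exact: cvg_id|exact: cvg_cst].
    exact: cM.
  - have cG (x : R) : a - 1 < x -> {for x, continuous (G n)}.
      move=> ax; apply: differentiable_continuous; apply/derivable1_diffP.
      exact: (@ex_derive _ _ _ _ _ _ _ (dG n x ax)).
    split.
    + move=> x; rewrite in_itv/= => /andP[ax _].
      by apply: (@ex_derive _ _ _ _ _ _ _ (dG n x _)); lra.
    + by apply: cvg_at_right_filter; apply: cG; lra.
    + by apply: cvg_at_left_filter; apply: cG; lra.
  - move=> x; rewrite in_itv/= => /andP[ax _].
    by rewrite derive1E (@derive_val _ _ _ _ _ _ _ (dG n x _))//; lra.
under eq_fun do rewrite intE.
apply: cvg_EFin; first exact: nearW.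
have GE (x : R) : a - 1 < x -> G n x @[n --> \oo] --> M x.
  move=> ax; have := is_derive_diffquot (dQ _ ax).
  apply: cvg_trans; apply: near_eq_cvg; apply: nearW => n.
  by rewrite /G [RHS]mulrC.
by apply: cvgB; apply: GE; lra.
Qed.

Lemma ae_itv_oocc (Q : R -> Prop) a b :
  {ae leb, forall t, t \in `]a, b[ -> Q t} ->
  {ae leb, forall t, t \in `[a, b] -> Q t}.
Proof.
move=> aeQ.
have nN c : leb.-negligible [set c].
  by exists [set c]; split => //; exact: lebesgue_measure_set1.
have := negligibleU (negligibleU (nN a) (nN b)) aeQ.
apply: negligibleS => t /=; apply: contra_notP => /not_orP[/not_orP[ta tb]].
rewrite notK => Qt; rewrite in_itv/= => /andP[at_ tb_]; apply: Qt.
by rewrite in_itv/= !lt_neqAle at_ tb_ !andbT eq_sym; apply/andP; split; apply/eqP.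
Qed.

(** Fatou's lemma applied to the difference quotients of [M]. Only an inequality
    can hold: the derivative misses the singular part of [M]. *)
Lemma nondecreasing_integral_derive_le M (m : R -> R) a b : a < b ->
  {homo M : s t / s <= t} -> continuous M ->
  measurable_fun (`[a, b] : set R) m ->
  {ae leb, forall t, t \in `]a, b[ -> is_derive t 1 M (m t)} ->
  (\int[leb]_(t in `[a, b]) (m t)%:E <= (M b - M a)%:E)%E.
Proof.
move=> ab ndM cM mm /ae_itv_oocc dM.
have {}dM : {ae leb, forall t, t \in `[a, b] ->
    0 <= m t /\ is_derive t 1 M (m t)}.
  apply: (ae_imply dM) => t /= dMt abt.
  by split; [exact: nondecreasing_is_derive_ge0 (dMt abt)|exact: dMt].
pose q n t : \bar R := ((M (t + @harmonic R n) - M t) / @harmonic R n)%:E.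
have mq n : measurable_fun (`[a, b] : set R) (q n).
  apply/measurable_EFinP; apply: measurable_funTS; apply: continuous_measurable_fun.
  move=> x; apply: cvgMl; apply: cvgB; last exact: cM.
  apply: (@cvg_comp _ _ _ (fun x => x + @harmonic R n) M _ (nbhs (x + @harmonic R n))).
    by apply: cvgD; [exact: cvg_id|exact: cvg_cst].
  exact: cM.
have q0 n t : [set` `[a, b]] t -> (0 <= q n t)%E by rewrite lee_fin diffquot_ge0.
have := fatou leb (measurable_itv `[a, b]) mq q0.
rewrite [X in (_ <= X)%E -> _](_ : _ = (M b - M a)%:E); last first.
  have qc := cvg_integral_diffquot ab cM.
  by rewrite is_cvg_limn_einfE; [exact/cvg_lim|apply/cvg_ex; eexists; exact: qc].
apply: le_trans.
(* [m] is nonnegative only almost everywhere, while comparing integrals needs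
   nonnegative integrands. *)
rewrite [leLHS](@ae_eq_integral _ _ _ leb `[a, b]
  (fun t => (Num.max (m t) 0)%:E))//; last 3 first.
- exact/measurable_EFinP.
- by apply/measurable_EFinP; apply: measurable_funrpos.
- apply: (ae_imply dM) => t /= dMt abt.
  by rewrite max_l//; exact: (dMt abt).1.
apply: ae_ge0_le_integral => //.
- by move=> t _; rewrite lee_fin le_max lexx orbT.
- by apply/measurable_EFinP; apply: measurable_funrpos.
- move=> t abt; rewrite limn_einf_lim; apply: lime_ge.
    exact: is_cvg_einfs.
  by apply: nearW => n; apply: le_ereal_inf_tmp => _ [k /= _ <-]; exact: q0.
- rewrite /limn_einf; apply: measurableT_comp => //.
  by apply: measurable_fun_limn_esup => n; apply: measurableT_comp (mq n).
- apply: (ae_imply dM) => t /= dMt abt.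
  have [mt0 {}dMt] := dMt abt.
  have qt : q n t @[n --> \oo] --> (m t)%:E.
    by apply: cvg_EFin; [exact: nearW|exact: is_derive_diffquot dMt].
  by rewrite max_l// is_cvg_limn_einfE ?(cvg_lim _ qt)//.
Qed.

(** [P + F] and [P - F] are both nondecreasing, so the inequality for monotone
    functions holds for [F] in both directions as soon as it is an equality
    for [P]. *)
Lemma dominated_increments_FTC F P (f g : R -> R) a b : a < b ->
  continuous P -> (forall s t, s <= t -> `|F t - F s| <= P t - P s) ->
  measurable_fun (`[a, b] : set R) f -> measurable_fun (`[a, b] : set R) g ->
  {ae leb, forall t, t \in `]a, b[ -> is_derive t 1 F (f t)} ->
  {ae leb, forall t, t \in `]a, b[ -> is_derive t 1 P (g t)} ->
  (\int[leb]_(t in `[a, b]) (g t)%:E = (P b - P a)%:E)%E ->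
  leb.-integrable `[a, b] (EFin \o f) /\
  (\int[leb]_(t in `[a, b]) (f t)%:E = (F b - F a)%:E)%E.
Proof.
move=> ab cP FP mf mg dF dP intg.
have cF : continuous F.
  move=> x; apply/cvgrPdist_le => e e0.
  have /cvgrPdist_le/(_ e e0) := cP x; apply: filterS => y; apply: le_trans.
  have [xy|/ltW yx] := leP x y.
    by rewrite distrC (le_trans (FP _ _ xy))// distrC ler_norm.
  by rewrite (le_trans (FP _ _ yx))// ler_norm.
(* The monotone inequality for [P + G]; it is used with [G = F] and [G = - F]. *)
have half (G : R -> R) (k : R -> R) : continuous G ->
  (forall s t, s <= t -> `|G t - G s| <= P t - P s) ->
  measurable_fun (`[a, b] : set R) k ->
  {ae leb, forall t, t \in `]a, b[ -> is_derive t 1 G (k t)} ->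
  {ae leb, forall t, t \in `]a, b[ -> 0 <= g t + k t} /\
  (\int[leb]_(t in `[a, b]) (g t + k t)%:E <= (P b - P a + (G b - G a))%:E)%E.
  move=> cG GP mk dG.
  have ndPG : {homo (P \+ G) : s t / s <= t}.
    by move=> s t st /=; have := GP s t st; rewrite ler_norml => /andP[]; lra.
  have dPG : {ae leb, forall t, t \in `]a, b[ ->
      is_derive t 1 (P \+ G) (g t + k t)}.
    apply: (ae_imply2 dP dG) => t /= dPt dGt abt.
    by apply: is_deriveD; [exact: dPt|exact: dGt].
  split.
    apply: (ae_imply dPG) => t /= dPGt abt.
    exact: nondecreasing_is_derive_ge0 (dPGt abt).
  have -> : P b - P a + (G b - G a) = (P \+ G) b - (P \+ G) a by rewrite /=; ring.
  apply: nondecreasing_integral_derive_le => //.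
    by move=> x; apply: cvgD; [exact: cP|exact: cG].
  exact: measurable_funD.
have NFP s t : s <= t -> `|(\- F) t - (\- F) s| <= P t - P s.
  by move=> st; rewrite /= opprK addrC distrC FP.
have cNF : continuous (\- F) by move=> x; apply: cvgN; exact: cF.
have mNf : measurable_fun (`[a, b] : set R) (\- f) by exact: measurableT_comp.
have dNF : {ae leb, forall t, t \in `]a, b[ -> is_derive t 1 (\- F) ((\- f) t)}.
  apply: (ae_imply dF) => t /= dFt abt.
  by apply: is_deriveN; exact: dFt.
have [gf0 gf] := half F f cF FP mf dF.
have [gNf0 gNf] := half (\- F) (\- f) cNF NFP mNf dNF.
have g0 : {ae leb, forall t, t \in `[a, b] -> `|f t| <= g t}.
  apply: ae_itv_oocc.
  apply: (ae_imply2 gf0 gNf0) => t /= h1 h2 abt.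
  by rewrite ler_norml; have := h1 abt; have := h2 abt; lra.
have ig : leb.-integrable `[a, b] (EFin \o g).
  apply/integrableP; split; first exact/measurable_EFinP.
  rewrite (@ae_eq_integral _ _ _ leb `[a, b] (EFin \o g))//.
  - by rewrite intg ltry.
  - by apply: measurableT_comp => //; exact/measurable_EFinP.
  - exact/measurable_EFinP.
  apply: (ae_imply g0) => t /= fg abt.
  by rewrite ger0_norm// (le_trans _ (fg abt)).
have if_ : leb.-integrable `[a, b] (EFin \o f).
  apply/integrableP; split; first exact/measurable_EFinP.
  have /integrableP[_] := ig; apply: le_lt_trans.
  apply: ae_ge0_le_integral => //.
  - by apply: measurableT_comp => //; exact/measurable_EFinP.
  - by apply: measurableT_comp => //; exact/measurable_EFinP.
  apply: (ae_imply g0) => t /= fg abt.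
  by rewrite lee_fin (le_trans (fg abt))// ler_norm.
split=> //.
have fE : (\int[leb]_(t in `[a, b]) (f t)%:E)%E \is a fin_num.
  exact: integrable_fin_num.
have iNf : leb.-integrable `[a, b] (EFin \o (\- f)).
  by rewrite (_ : _ \o _ = (\- (EFin \o f))%E)//; exact: integrableN.
move: gf gNf; rewrite (@integralD_EFin _ _ _ leb _ _ g f)//.
rewrite (@integralD_EFin _ _ _ leb _ _ g (\- f))//.
rewrite (_ : (EFin \o (\- f)) = (fun t => - (f t)%:E)%E)// integralN//=; last first.
  by apply: integrable_add_def.
rewrite intg -(fineK fE) -!EFinD !lee_fin => gf gNf; congr EFin.
by apply/eqP; rewrite eq_le; apply/andP; split; lra.
Qed.
End monotone_and_dominated.

Section primitive.
Context {R : realType}.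
Local Notation leb := (@lebesgue_measure R).
Implicit Types (F P f g : R -> R) (a b s t : R).

Definition clamp a b t : R := Num.max a (Num.min b t).

Lemma clamp_itv a b t : a <= b -> clamp a b t \in `[a, b].
Proof. by move=> ab; rewrite in_itv/= le_max lexx ge_max ab ge_min lexx. Qed.

Lemma clamp_id a b t : t \in `[a, b] -> clamp a b t = t.
Proof. by rewrite in_itv/= => /andP[at_ tb]; rewrite /clamp min_r// max_r. Qed.

Lemma clamp_le a b s t : s <= t -> clamp a b s <= clamp a b t.
Proof. by move=> st; rewrite /clamp; apply: le_max2 => //; exact: le_min2. Qed.

Lemma clamp_continuous (M : topologicalType) (F : R -> M) a b :
  a <= b -> {within `[a, b], continuous F} ->
  continuous (F \o clamp a b).
Proof.
move=> ab /subspace_continuousP cF x S /(cF _ (clamp_itv x ab)) clS.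
have cc : {for x, continuous (clamp a b)}.
  apply: continuous_max; first exact: cvg_cst.
  by apply: continuous_min; [exact: cvg_cst|exact: cvg_id].
have {}clS : nbhs (clamp a b x) [set y | `[a, b]%classic y -> S (F y)] by exact: clS.
by apply: (@filterS _ (nbhs x) _ _ _ _ (cc _ clS)) => y; apply; exact: clamp_itv.
Qed.

Lemma is_derive_clamp a b F t (df : R) : t \in `]a, b[ ->
  is_derive t 1 F df -> is_derive t 1 (F \o clamp a b) df.
Proof.
move=> abt; apply: near_eq_is_derive.
have := near_in_itvoo abt; apply: filterS => y aby /=.
by rewrite clamp_id//; exact: subset_itv_oo_cc.
Qed.

(** The primitive is made constant outside [[a, b]] by clamping its argument,
    which makes it continuous on the whole line; its derivative comes from
    Lebesgue's differentiation theorem. *)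
Lemma integrable_primitive g a b : a < b ->
  leb.-integrable `[a, b] (EFin \o g) ->
  exists P, [/\ continuous P,
    forall s t, a <= s -> s <= t -> t <= b ->
      (\int[leb]_(u in `[s, t]) (g u)%:E = (P t - P s)%:E)%E &
    {ae leb, forall t, t \in `]a, b[ -> is_derive t 1 P (g t)}].
Proof.
move=> ab ig.
pose P0 t := (\int[leb]_(u in `[a, t]) g u)%R.
have igS s t : a <= s -> t <= b -> leb.-integrable `[s, t] (EFin \o g).
  move=> as_ tb; apply: integrableS ig => //.
  by apply: subset_itv; rewrite bnd_simp.
exists (P0 \o clamp a b); split.
- apply: clamp_continuous; first exact: ltW.
  by apply: parameterized_integral_continuous => //; exact: ltW.
- move=> s t as_ st tb /=.
  rewrite !clamp_id; last 2 first.
  - by rewrite in_itv/= as_ (le_trans st).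
  - by rewrite in_itv/= (le_trans as_).
  have := @Rintegral_itvB R g (BLeft a) (BRight t) s (igS a t (lexx a) tb).
  rewrite !bnd_simp => /(_ as_ st); rewrite /P0 => ->.
  rewrite Rintegral_itv_obnd_cbnd; last first.
    by apply: integrableS (igS s t as_ tb) => //; exact: subset_itv_oc_cc.
  rewrite fineK//; apply: integrable_fin_num => //; exact: igS.
- pose g' := g \_ `[a, b].
  have ig' : leb.-integrable setT (EFin \o g').
    by rewrite -restrict_EFin; apply/integrable_restrict => //; rewrite setTI.
  have ig'y y : leb.-integrable `[a, y] (EFin \o g') by exact: integrableS ig'.
  have dP := @FTC1 R g' (BLeft a) ig'y (open_integrable_locally openT ig').
  apply: (ae_imply dP) => t /= + abt.
  have [at_ tb] : a < t /\ t < b by move: abt; rewrite in_itv/= => /andP.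
  rewrite lte_fin => /(_ at_) dP0; apply: (is_derive_clamp abt).
  have g'E y : y \in `[a, b] -> g' y = g y.
    by move=> aby; rewrite /g' patchE mem_set.
  have dg' : is_derive t 1 (fun x => \int[leb]_(u in `[a, x]) g' u)%R (g t).
    rewrite -[g t]g'E; last by rewrite in_itv/= !ltW.
    by split; [exact: dP0.1|rewrite -derive1E; exact: dP0.2].
  apply: near_eq_is_derive dg'.
  have := near_in_itvoo abt; apply: filterS => y aby /=.
  apply: eq_Rintegral => u; rewrite inE/= => ayu; apply: g'E.
  move: ayu aby; rewrite !in_itv/= => /andP[-> uy] /andP[_ yb].
  by rewrite (le_trans uy)// ltW.
Qed.

(** Lebesgue's fundamental theorem of calculus, with absolute continuity
    expressed by an integrable bound on the increments. Clamping turns the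
    estimate on [[a, b]] into one on the whole line, so that difference quotients
    taken near [b] stay under control. *)
Lemma absolutely_continuous_FTC F f g a b : a < b ->
  leb.-integrable `[a, b] (EFin \o g) ->
  (forall s t, a <= s -> s <= t -> t <= b ->
    (`|F t - F s|%:E <= \int[leb]_(u in `[s, t]) (g u)%:E)%E) ->
  measurable_fun (`[a, b] : set R) f ->
  {ae leb, forall t, t \in `]a, b[ -> is_derive t 1 F (f t)} ->
  leb.-integrable `[a, b] (EFin \o f) /\
  (\int[leb]_(t in `[a, b]) (f t)%:E = (F b - F a)%:E)%E.
Proof.
move=> ab ig FP mf dF; have [P [cP gP dP]] := integrable_primitive ab ig.
have abab := ltW ab.
have c_ x := clamp_itv x abab.
have [aa bb] : clamp a b a = a /\ clamp a b b = b.
  by rewrite !clamp_id// in_itv/= lexx ?abab.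
have := @dominated_increments_FTC R (F \o clamp a b) (P \o clamp a b) f g a b ab.
rewrite /= aa bb; apply => //.
- by apply: clamp_continuous => //; exact: continuous_subspaceT.
- move=> s t st /=; rewrite -lee_fin.
  have := c_ s; have := c_ t; rewrite !in_itv/= => /andP[_ tb] /andP[sa _].
  by have stc := clamp_le a b st; rewrite -gP// FP.
- by apply/measurable_EFinP; exact: measurable_int ig.
- apply: (ae_imply dF) => t /= dFt abt.
  by apply: is_derive_clamp => //; exact: dFt.
- apply: (ae_imply dP) => t /= dPt abt.
  by apply: is_derive_clamp => //; exact: dPt.
- by rewrite gP.
Qed.

End primitive.

(** * Functions with continuous partial derivatives *)

Section partial_derivatives.
Context {R : realType} {V : normedModType R}.
Implicit Types (f : V -> R) (p q e : V).

Lemma is_derive_line f q e (s : R) : derivable f (q + s *: e) e ->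
  is_derive s 1 (fun u => f (q + u *: e)) ('D_e f (q + s *: e)).
Proof.
move=> df.
have E : (fun h : R => h^-1 *: (f (q + (h *: 1 + s) *: e) - f (q + s *: e))) =
         (fun h : R => h^-1 *: (f (h *: e + (q + s *: e)) - f (q + s *: e))).
  apply/funext => h; congr (_ *: (f _ - _)).
  by rewrite -[h *: 1]/(h * 1) mulr1 scalerDl addrCA addrA.
by split; rewrite /derivable /derive E.
Qed.

Lemma mean_value_direction f q e (z : R) : (forall x, derivable f x e) ->
  exists2 s : R, `|s| <= `|z| & f (q + z *: e) - f q = z * 'D_e f (q + s *: e).
Proof.
move=> df; pose g (u : R) := f (q + u *: e).
have dg (u : R) : is_derive u 1 g ('D_e f (q + u *: e)) by exact: is_derive_line.
have cg a b : {within `[a, b], continuous g}.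
  apply: derivable_within_continuous => u _.
  exact: (@ex_derive _ _ _ _ _ _ _ (dg u)).
have g0 : g 0 = f q by rewrite /g scale0r addr0.
have [z0|z0] := leP 0 z.
  have [c + gE] := MVT_segment z0 (fun x _ => dg x) (cg 0 z).
  rewrite in_itv/= => /andP[c0 cz]; exists c; first by rewrite !ger0_norm.
  by move: gE; rewrite g0 subr0 mulrC.
have [c + gE] := MVT_segment (ltW z0) (fun x _ => dg x) (cg z 0).
rewrite in_itv/= => /andP[zc c0]; exists c.
  by rewrite !ler0_norm ?lerN2// ltW.
by move: gE; rewrite g0 sub0r mulrN mulrC -opprB => /oppr_inj.
Qed.

(** Moving along one direction at a time reduces the increment of [f] to mean
    values of its directional derivatives. With [L = 0] and [eps] a global bound
    this is a Lipschitz estimate; with [L i] the derivative at [p] and [eps] small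
    it is differentiability at [p]. *)
Lemma increment_partial_estimate (I : Type) (e : I -> V) f p (z L : I -> R)
    (eps rho : R) (r : seq I) :
  (forall i x, derivable f x (e i)) ->
  (forall i x, `|x - p| <= rho -> `|'D_(e i) f x - L i| <= eps) ->
  \sum_(i <- r) `|z i| * `|e i| <= rho ->
  `|f (p + \sum_(i <- r) z i *: e i) - f p - \sum_(i <- r) z i * L i|
    <= eps * \sum_(i <- r) `|z i|.
Proof.
move=> df DfL; elim: r => [|j r IH] rrho.
  by rewrite !big_nil addr0 subrr subr0 normr0 mulr0.
have jr : `|z j| * `|e j| + \sum_(i <- r) `|z i| * `|e i| <= rho.
  by move: rrho; rewrite big_cons.
have {}IH : `|f (p + \sum_(i <- r) z i *: e i) - f p - \sum_(i <- r) z i * L i|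
    <= eps * \sum_(i <- r) `|z i|.
  by apply: IH; apply: le_trans jr; rewrite lerDr mulr_ge0.
rewrite !big_cons; set S := \sum_(i <- r) _ *: _ in IH *.
have [s sz fE] := mean_value_direction (p + S) (z j) (df j).
have Sle : `|S| <= \sum_(i <- r) `|z i| * `|e i|.
  by apply: (le_trans (ler_norm_sum _ _ _)); apply: ler_sum => i _; rewrite normrZ.
have xrho : `|p + S + s *: e j - p| <= rho.
  rewrite (_ : _ - p = s *: e j + S); last first.
    by rewrite addrAC [p + S]addrC addrK addrC.
  apply: le_trans jr; apply: (le_trans (ler_normD _ _)); rewrite lerD// normrZ.
  by rewrite ler_wpM2r.
have Dj := DfL j _ xrho.
rewrite mulrDr [z j *: e j + S]addrC [p + (S + _)]addrA.
have -> : f (p + S + z j *: e j) - f p - (z j * L j + \sum_(i <- r) z i * L i) =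
   z j * ('D_(e j) f (p + S + s *: e j) - L j) +
   (f (p + S) - f p - \sum_(i <- r) z i * L i).
  by rewrite mulrBr -fE; ring.
apply: (le_trans (ler_normD _ _)); rewrite lerD//.
by rewrite normrM mulrC ler_wpM2r.
Qed.

(** The chain rule along a curve, for a function whose partial derivatives exist
    everywhere and are continuous at the point of interest. *)
Lemma is_derive_comp_partial (I : finType) (e : I -> V) f p (c : I -> R -> R)
    (c' : I -> R) (t : R) (r : seq I) :
  let y s := p + \sum_(i <- r) c i s *: e i in
  (forall i x, derivable f x (e i)) ->
  (forall i, {for y t, continuous (fun x => 'D_(e i) f x)}) ->
  (forall i, is_derive t 1 (c i) (c' i)) ->
  is_derive t 1 (f \o y) (\sum_(i <- r) c' i * 'D_(e i) f (y t)).
Proof.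
move=> y df cDf dc.
pose z i (h : R) := c i (h + t) - c i t.
have cz i : h^-1 * z i h @[h --> 0^'] --> c' i.
  have [/= dci <-] := dc i.
  have : h^-1 *: (c i (h *: 1 + t) - c i t) @[h --> 0^'] --> 'D_1 (c i) t by [].
  by under eq_fun do rewrite -[_ *: 1]/(_ * 1) mulr1.
suff H : h^-1 * (f (y (h + t)) - f (y t)) @[h --> 0^'] -->
    \sum_(i <- r) c' i * 'D_(e i) f (y t).
  have H' : h^-1 *: ((f \o y) (h *: 1 + t) - (f \o y) t) @[h --> 0^'] -->
    \sum_(i <- r) c' i * 'D_(e i) f (y t).
    by under eq_fun do rewrite -[_ *: 1]/(_ * 1) mulr1.
  by split; [apply/cvg_ex; eexists; exact: H'|exact/cvg_lim].
pose L i := 'D_(e i) f (y t).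
have main : \sum_(i <- r) (h^-1 * z i h) * L i @[h --> 0^'] -->
    \sum_(i <- r) c' i * L i.
  apply: cvg_big => // [|i _]; first exact: add_continuous.
  by apply: cvgMl; exact: cz.
have Nz : \sum_(i <- r) `|h^-1 * z i h| @[h --> 0^'] --> \sum_(i <- r) `|c' i|.
  apply: cvg_big => // [|i _]; first exact: add_continuous.
  by apply: cvg_norm; exact: cz.
have z0 i : z i h @[h --> 0^'] --> (0 : R).
  have : h * (h^-1 * z i h) @[h --> 0^'] --> 0 * c' i.
    by apply: cvgM (cz i); exact: cvg_within.
  rewrite mul0r; apply: cvg_trans; apply: near_eq_cvg.
  by near=> h; rewrite mulrA divff ?mul1r//; near: h; exact: nbhs_dnbhs_neq.
have zrho : \sum_(i <- r) `|z i h| * `|e i| @[h --> 0^'] --> (0 : R).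
  rewrite [X in _ --> X](_ : _ = \sum_(i <- r) `|0 : R| * `|e i|); last first.
    by rewrite big1// => i _; rewrite normr0 mul0r.
  apply: cvg_big => // [|i _]; first exact: add_continuous.
  by apply: cvgMl; apply: cvg_norm; exact: z0.
have yE h : y (h + t) = y t + \sum_(i <- r) z i h *: e i.
  rewrite /y -addrA -big_split/=; congr (_ + _); apply: eq_bigr => i _.
  by rewrite /z -scalerDl [c i t + _]addrC subrK.
(* Split off the linear part; what remains is bounded by [eps / U] times a sum
   that tends to [U - 1]. *)
rewrite -[X in _ --> X]add0r.
rewrite (_ : (fun h => _) = (fun h => (h^-1 * (f (y (h + t)) - f (y t)) -
   \sum_(i <- r) (h^-1 * z i h) * L i) +
   \sum_(i <- r) (h^-1 * z i h) * L i)); last first.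
  by apply/funext => h; rewrite subrK.
apply: cvgD => //; apply/cvgrPdist_le => eps eps0.
pose U := \sum_(i <- r) `|c' i| + 1.
have U0 : 0 < U by rewrite ltr_wpDl// sumr_ge0.
have epsU0 : 0 < eps / U by rewrite divr_gt0.
have /nbhs_ballP[rho /= rho0 Drho] : \forall x \near y t,
    forall i, `|'D_(e i) f x - L i| <= eps / U.
  apply: filter_forall => i; have /cvgrPdist_le/(_ _ epsU0) := cDf i.
  by apply: filterS => x; rewrite distrC.
near=> h.
have h0 : h != 0 by near: h; exact: nbhs_dnbhs_neq.
have zr : \sum_(i <- r) `|z i h| * `|e i| <= rho / 2.
  near: h; apply: (cvgr_le 0 zrho); exact: divr_gt0.
have zU : \sum_(i <- r) `|h^-1 * z i h| <= U.
  near: h; apply: (cvgr_le _ Nz); by rewrite ltrDl.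
have := @increment_partial_estimate I e f (y t) (z^~ h) L (eps / U) (rho / 2) r
  df _ zr.
rewrite -yE => /(_ _) est; rewrite sub0r normrN.
rewrite (_ : _ - _ =
    h^-1 * (f (y (h + t)) - f (y t) - \sum_(i <- r) z i h * L i)); last first.
  rewrite [RHS]mulrBr mulr_sumr; congr (_ - _).
  by apply: eq_bigr => i _; rewrite mulrA.
rewrite normrM; apply: (@le_trans _ _ (`|h^-1| * (eps / U * \sum_(i <- r) `|z i h|))).
  rewrite ler_wpM2l// est// => i x xrho; apply: Drho.
  by rewrite -ball_normE/= distrC (le_lt_trans xrho)// ltr_pdivrMr// ltr_pMr// ltr1n.
rewrite mulrCA mulr_sumr; under eq_bigr do rewrite -normrM.
by rewrite -mulrA ler_piMr ?(ltW eps0)// mulrC ler_pdivrMr// mul1r.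
Unshelve. all: by end_near. Qed.

End partial_derivatives.

(** * Test functions on space-time *)

Section test_functions.
Context {R : realType} {d : nat}.
Implicit Types (zeta : R * 'rV[R]_d -> R) (u x y : 'rV[R]_d).

(** [None] is the direction of time. *)
Definition spacetime_dir (i : option 'I_d) : R * 'rV[R]_d :=
  if i is Some j then (0, delta_mx 0 j) else (1, 0).

Local Notation dirs := (None :: map Some (index_enum 'I_d)).

Lemma sum_spacetime_dir (s : R) x (c : option 'I_d -> R) :
  c None = s -> (forall j, c (Some j) = x 0 j) ->
  \sum_(i <- dirs) c i *: spacetime_dir i = (s, x).
Proof.
move=> cs cx; rewrite big_cons big_map /= cs.
under eq_bigr do rewrite cx.
rewrite [x in RHS]row_sum_delta.
have -> : \sum_(i <- index_enum 'I_d) x 0 i *: ((0, delta_mx 0 i) : R * 'rV[R]_d) =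
    (0, \sum_j x 0 j *: delta_mx 0 j).
  apply: (big_rec2 (fun a b => a = (0, b))) => // i _ b _ ->.
  by congr pair; rewrite /= ?scaler0 ?addr0.
by congr pair; rewrite /= ?scaler0 ?addr0 ?add0r// -[_ *: _]/(s * 1) mulr1.
Qed.

Lemma test_function_partial T zeta v : test_function T zeta ->
  (forall p, derivable zeta p v) /\ continuous (fun p => 'D_v zeta p).
Proof.
by case=> /(_ 1%N)/= [_ /(_ v)[dz [cDz _]]] _ _.
Qed.

Lemma test_function_continuous T zeta : test_function T zeta -> continuous zeta.
Proof. by case=> /(_ 0%N)/= []. Qed.

Lemma compactly_supported_bounded (K : set (R * 'rV[R]_d)) zeta :
  compact K -> continuous zeta -> (forall p, ~ K p -> zeta p = 0) ->
  exists2 C, 0 <= C & forall p, `|zeta p| <= C.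
Proof.
move=> cK cz zK.
have : compact (zeta @` K).
  by apply: continuous_compact => //; exact: continuous_subspaceT.
move=> /compact_bounded[M [_ /(_ (`|M| + 1))]].
rewrite (le_lt_trans (ler_norm M)) ?ltrDl// => /(_ isT) zM.
exists (`|M| + 1); first by rewrite addr_ge0.
move=> p; have [Kp|/zK->] := pselect (K p); last by rewrite normr0 addr_ge0.
by apply: zM; exists p.
Qed.

Lemma test_function_bounded T zeta : test_function T zeta ->
  exists2 C, 0 <= C & forall p, `|zeta p| <= C.
Proof.
move=> tz; have [_ cK _] := tz.
apply: (compactly_supported_bounded cK); first exact: test_function_continuous tz.
move=> p Kp; apply/eqP; apply: contra_notT Kp => zp0; exact: subset_closure.
Qed.

(** Off its support a test function vanishes on a neighbourhood, hence so do its
    derivatives, which are therefore compactly supported as well. *)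
Lemma test_function_partial_bounded T zeta v : test_function T zeta ->
  exists2 C, 0 <= C & forall p, `|'D_v zeta p| <= C.
Proof.
move=> tz; have [_ cK _] := tz.
apply: (compactly_supported_bounded cK); first exact: (test_function_partial v tz).2.
move=> p Kp; rewrite (@near_eq_derive _ _ _ zeta (cst 0)) ?derive_cst//.
have : \forall q \near p, (~` closure [set p | zeta p != 0]) q.
  by apply: open_nbhs_nbhs; split => //; apply: closed_openC; exact: closed_closure.
apply: filterS => q /= Kq; apply/eqP; apply: contra_notT Kq => zq0.
exact: subset_closure.
Qed.

(** Bounded partial derivatives in the [d + 1] directions of space-time, with each
    space increment at most the Euclidean norm. *)
Lemma test_function_lipschitz T zeta : test_function T zeta ->
  exists2 C, 0 <= C & forall s t x y,
    `|zeta (t, y) - zeta (s, x)| <= C * (`|t - s| + enorm (y - x)).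
Proof.
move=> tz.
have /choice[C HC] : forall i, exists C,
    0 <= C /\ forall p, `|'D_(spacetime_dir i) zeta p| <= C.
  move=> i; have [C C0 HC] := test_function_partial_bounded (spacetime_dir i) tz.
  by exists C.
pose C0 := \sum_i C i.
have C00 : 0 <= C0 by apply: sumr_ge0 => i _; exact: (HC i).1.
have DC i p : `|'D_(spacetime_dir i) zeta p| <= C0.
  apply: le_trans ((HC i).2 p) _; rewrite /C0 (bigD1 i)//= lerDl.
  by apply: sumr_ge0 => j _; exact: (HC j).1.
exists (C0 * d.+1%:R); first by rewrite mulr_ge0.
move=> s t x y.
pose z (i : option 'I_d) : R := if i is Some j then (y - x) 0 j else t - s.
have := @increment_partial_estimate R (R * 'rV[R]_d)%type _ spacetime_dir zeta
  (s, x) z (fun=> 0) C0 _ dirs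
  (fun i => (test_function_partial (spacetime_dir i) tz).1) _ (lexx _).
rewrite (@sum_spacetime_dir (t - s) (y - x) z erefl (fun=> erefl)).
have -> : ((s, x) : R * 'rV[R]_d) + (t - s, y - x) = (t, y).
  by congr pair; rewrite /= addrC subrK.
rewrite [X in _ - X]big1 ?subr0; last by move=> i _; rewrite mulr0.
move=> lip; apply: le_trans (lip _) _; first by move=> i p _; rewrite subr0.
rewrite -mulrA ler_wpM2l// big_cons big_map /=.
have -> : d.+1%:R * (`|t - s| + enorm (y - x)) =
  `|t - s| + d%:R * enorm (y - x) + (enorm (y - x) + d%:R * `|t - s|).
  by rewrite -natr1; ring.
rewrite -[leLHS]addr0 lerD//; last by rewrite addr_ge0 ?enorm_ge0// mulr_ge0.
rewrite lerD2l; have -> : d%:R * enorm (y - x) = \sum_(j < d) enorm (y - x).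
  by rewrite sumr_const card_ord mulr_natl.
by apply: ler_sum => j _; exact: coord_le_enorm.
Qed.

Lemma time_derivativeE zeta t x :
  time_derivative zeta t x = 'D_((1, 0) : R * 'rV[R]_d) zeta (t, x).
Proof.
rewrite /time_derivative derive1E /derive.
suff -> : (fun h : R => h^-1 *: (zeta (h *: 1 + t, x) - zeta (t, x))) =
  (fun h : R => h^-1 *: (zeta (h *: ((1, 0) : R * 'rV[R]_d) + (t, x)) -
                         zeta (t, x))) by [].
apply/funext => h; congr (_ *: (zeta _ - _)).
by congr pair => /=; rewrite ?scaler0 ?add0r.
Qed.

Lemma space_gradientE zeta t x j :
  space_gradient zeta t x 0 j = 'D_((0, delta_mx 0 j) : R * 'rV[R]_d) zeta (t, x).
Proof.
rewrite /space_gradient mxE /derive.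
suff -> : (fun h : R => h^-1 *: (zeta (t, h *: delta_mx 0 j + x) - zeta (t, x))) =
  (fun h : R => h^-1 *: (zeta (h *: ((0, delta_mx 0 j) : R * 'rV[R]_d) + (t, x)) -
                         zeta (t, x))) by [].
apply/funext => h; congr (_ *: (zeta _ - _)).
by congr pair => /=; rewrite ?scaler0 ?add0r.
Qed.

Lemma test_function_chain T zeta (x : R -> 'rV[R]_d) (t : R) u :
  test_function T zeta -> is_derive t 1 x u ->
  is_derive t 1 (fun s => zeta (s, x s))
    (time_derivative zeta t (x t) + dotp (space_gradient zeta t (x t)) u).
Proof.
move=> tz dx.
pose c (i : option 'I_d) (s : R) : R := if i is Some j then x s 0 j else s.
pose c' (i : option 'I_d) : R := if i is Some j then u 0 j else 1.
have dc i : is_derive t 1 (c i) (c' i).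
  case: i => [j|] /=; last exact: is_derive_id.
  have [dxt xtu] := dx; split; first exact: (derivable_mxP _ _ _).1.
  by rewrite -xtu (derive_mx dxt) mxE.
have := @is_derive_comp_partial R (R * 'rV[R]_d)%type _ spacetime_dir zeta 0 c c' t
  dirs
  (fun i => (test_function_partial (spacetime_dir i) tz).1)
  (fun i => (test_function_partial (spacetime_dir i) tz).2 _) dc.
have yE s : 0 + \sum_(i <- dirs) c i s *: spacetime_dir i = (s, x s).
  by rewrite add0r; exact: sum_spacetime_dir.
rewrite (_ : _ \o _ = fun s => zeta (s, x s)); last first.
  by apply/funext => s /=; rewrite yE.
rewrite yE big_cons big_map mul1r time_derivativeE /dotp.
by under [in X in _ -> X]eq_bigr do rewrite space_gradientE mulrC.
Qed.

Lemma test_function_boundary T zeta x : test_function T zeta ->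
  zeta (0, x) = 0 /\ zeta (T, x) = 0.
Proof.
move=> [_ _ KT]; split; apply/eqP; apply/negPn/negP => z0.
  have [] := KT (0, x) (@subset_closure _ [set p | zeta p != 0] _ z0).
  by rewrite /= in_itv/= ltxx.
have [] := KT (T, x) (@subset_closure _ [set p | zeta p != 0] _ z0).
by rewrite /= in_itv/= ltxx andbF.
Qed.

End test_functions.

(** * Lipschitz and continuous functions on the cone *)

Section cone_observables.
Context {R : realType} {d : nat}.
Implicit Types (p q : cone R d).

(** Jordan's inequality up to a constant: [cos] decreases, so the chord of
    [sin] from [0] to [y] is steeper than the chord from [y] to [pi / 2]. *)
Lemma sin_ge_half (y : R) : 0 <= y -> y <= pi / 2 -> y <= 2 * sin y.
Proof.
move=> y0 yp; have pih := pihalf_lt2 R.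
have sin0_ : sin y >= 0 by apply: sin_ge0_pi; rewrite y0 /=; lra.
have csin (a b : R) : {within `[a, b], continuous (@sin R)}.
  by apply: continuous_subspaceT => ?; exact: continuous_sin.
have [c1 /[!in_itv]/= /andP[c10 c1y]] :=
  MVT_segment y0 (fun x _ => is_derive_sin x) (csin _ _).
have [c2 /[!in_itv]/= /andP[c2y c2p]] :=
  MVT_segment yp (fun x _ => is_derive_sin x) (csin _ _).
rewrite sin_pihalf sin0 !subr0 => E2 E1.
have cc : cos c2 <= cos c1.
  by rewrite leNgt ltr_cos ?in_itv/= -?leNgt; lra.
have : y * (1 - sin y) <= (pi / 2 - y) * sin y.
  rewrite E2 E1 mulrC -mulrA (mulrC (cos c2)) -mulrA [X in _ * X <= _]mulrC.
  by rewrite ler_wpM2l ?subr_ge0// ler_wpM2r.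
have : 0 <= sin y * (2 - pi / 2) by rewrite mulr_ge0// subr_ge0 ltW.
lra.
Qed.

Lemma one_sub_cos_ge (a : R) : 0 <= a -> a <= pi -> a ^+ 2 <= 8 * (1 - cos a).
Proof.
move=> a0 ap; have s := @sin_ge_half (a / 2).
have -> : cos a = 1 - 2 * sin (a / 2) ^+ 2.
  have := cos_mulr2n (a / 2).
  rewrite (_ : a / 2 *+ 2 = a) => [->|]; last by rewrite -mulr_natr divfK.
  by have := cos2Dsin2 (a / 2); lra.
have : a / 2 <= 2 * sin (a / 2) by apply: s; lra.
nra.
Qed.

(** By the law of cosines, [d^2 = (r - s)^2 + 2 r s (1 - cos a)], and the last term
    is at least [min(r, s)^2 a^2 / 4]: the cone distance controls displacements of
    the position, weighted by the smaller radius. *)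
Lemma angle_le_cone_dist p q :
  Num.min (cone_rad p) (cone_rad q) *
  Num.min (enorm (cone_pos p - cone_pos q)) pi <= 2 * mdist p q.
Proof.
rewrite cone_mdistE /cone_dist.
set r := cone_rad p; set s := cone_rad q; set a := Num.min (enorm _) _.
have [r0 s0] : 0 <= r /\ 0 <= s by split; exact: cone_rad_ge0.
have a0 : 0 <= a by rewrite le_min enorm_ge0 pi_ge0.
have ap : a <= pi by rewrite ge_min lexx orbT.
have := one_sub_cos_ge a0 ap; have := cos_le1 a.
have := law_of_cosines_ge0 r s a.
move: (cos a) => c h0 c1 ha.
have m0 : 0 <= Num.min r s by rewrite le_min r0.
have mrs : Num.min r s ^+ 2 <= r * s.
  by rewrite expr2 ler_pM// ge_min lexx ?orbT.
rewrite -(@ler_pXn2r _ 2)// ?nnegrE ?mulr_ge0 ?sqrtr_ge0//.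
rewrite !exprMn sqr_sqrtr//.
have h1 := sqr_ge0 (r - s).
have h2 : Num.min r s ^+ 2 * a ^+ 2 <= r * s * (8 * (1 - c)).
  by rewrite ler_pM ?sqr_ge0.
lra.
Qed.

(** The factor [cone_rad ^ 2] compensates the degeneracy of the position at the
    vertex: the product of a bounded Lipschitz function of the position with it
    is Lipschitz for the cone distance on bounded sets. *)
Lemma cone_observable_lipschitz (z : R -> 'rV[R]_d -> R) (C L M : R) :
  0 <= C -> 0 <= L -> 0 <= M ->
  (forall t x, `|z t x| <= C) ->
  (forall s t x y, `|z t y - z s x| <= L * (`|t - s| + enorm (y - x))) ->
  exists2 K, 0 <= K & forall s t p q, cone_rad p <= M -> cone_rad q <= M ->
    `|z t (cone_pos q) * cone_rad q ^+ 2 - z s (cone_pos p) * cone_rad p ^+ 2|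
      <= K * (`|t - s| + mdist p q).
Proof.
move=> C0 L0 M0 zC zL; exists (4 * M * C + M ^+ 2 * L + 2 * M * L) => [|s t p q].
  by rewrite !addr_ge0// !mulr_ge0// sqr_ge0.
(* With [cone_rad p <= cone_rad q], the displacement of the position gets the
   factor [cone_rad p ^ 2]: one power is turned into a distance by
   [angle_le_cone_dist], the other is at most [M]. *)
wlog rs : s t p q / cone_rad p <= cone_rad q.
  move=> wlg pM qM; have [pq|/ltW qp] := leP (cone_rad p) (cone_rad q).
    exact: wlg.
  by rewrite distrC (distrC t) metric_sym; exact: wlg.
move=> _; have := angle_le_cone_dist p q; rewrite (min_l rs).
have := cone_rad_lip q p; rewrite metric_sym.
have := mdist_ge0 p q; move: (mdist p q) => D.
have := cone_rad_ge0 p; have := zC t (cone_pos q); have := zC s (cone_pos p).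
have := zL s t (cone_pos p) (cone_pos q); rewrite (enorm_distC (cone_pos q)).
have := enorm_ge0 (cone_pos p - cone_pos q).
have := normr_ge0 (t - s).
move: (cone_rad p) (cone_rad q) rs (z t _) (z s _) (enorm _) `|t - s|.
move=> r r' rr' z1 z2 e u u0 e0 z12 z2C z1C r0 D0 rD eD r'M.
have rM : r <= M by exact: le_trans r'M.
have {}rD : r' - r <= D by move: rD; rewrite ger0_norm// subr_ge0.
have h1 : `|z1 * (r' ^+ 2 - r ^+ 2)| <= C * (2 * M * D).
  rewrite normrM ler_pM// (_ : _ - _ = (r' - r) * (r' + r)); last by ring.
  by rewrite normrM !ger0_norm ?subr_ge0 ?addr_ge0//; nra.
have h2 : r * `|z1 - z2| <= 2 * C * D + L * (M * u + 2 * D).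
  have [ep|pe] := leP e pi.
    rewrite (min_l ep) in eD.
    have : r * `|z1 - z2| <= r * (L * (u + e)) by rewrite ler_wpM2l.
    have : L * (r * e) <= L * (2 * D) by rewrite ler_wpM2l.
    have : L * (r * u) <= L * (M * u) by rewrite ler_wpM2l// ler_wpM2r.
    have : 0 <= C * D by rewrite mulr_ge0.
    lra.
  (* The angle saturates at [pi]: here the points are far apart in the cone
     and boundedness of [z] replaces its Lipschitz constant. *)
  rewrite (min_r (ltW pe)) in eD.
  have pi2 := pi_ge2 R.
  have rpi : r <= D.
    have : r * 2 <= r * pi by rewrite ler_wpM2l.
    lra.
  have z12C : `|z1 - z2| <= 2 * C.
    by rewrite (le_trans (ler_normB _ _))//; lra.
  have : r * `|z1 - z2| <= D * (2 * C) by rewrite ler_pM.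
  have : 0 <= L * (M * u + 2 * D) by rewrite mulr_ge0// addr_ge0// mulr_ge0.
  lra.
have -> : z1 * r' ^+ 2 - z2 * r ^+ 2 =
    z1 * (r' ^+ 2 - r ^+ 2) + r * (r * (z1 - z2)) by ring.
apply: (le_trans (ler_normD _ _)).
have h3 : `|r * (r * (z1 - z2))| <= M * (2 * C * D + L * (M * u + 2 * D)).
  by rewrite !normrM !(ger0_norm r0) ler_pM// mulr_ge0.
have h4 : 0 <= M * C * u by rewrite !mulr_ge0.
have h5 : 0 <= M ^+ 2 * L * D by rewrite !mulr_ge0// sqr_ge0.
have h6 : 0 <= M * L * u by rewrite !mulr_ge0.
lra.
Qed.

(** The weight [cone_rad ^ 2] lets a bounded continuous function of the position
    extend continuously by zero to the vertex. *)
Lemma continuous_cone_observable (phi : 'rV[R]_d -> R) (C : R) : continuous phi ->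
  (forall x, `|phi x| <= C) ->
  continuous (fun q : cone R d => phi (cone_pos q) * cone_rad q ^+ 2).
Proof.
move=> cphi phiC q.
have crad2 : (cone_rad p ^+ 2) @[p --> q] --> (cone_rad q ^+ 2).
  under eq_fun do rewrite expr2; rewrite expr2.
  by apply: (@cvgM _ _ (nbhs q) (nbhs_filter q)); exact: cone_rad_continuous.
have [q0|q0] := ltP 0 (cone_rad q).
  apply: (@cvgM _ _ (nbhs q) (nbhs_filter q)) crad2.
  apply: (@continuous_comp _ _ _ (@cone_pos R d) phi); first exact: cone_pos_continuous.
  exact: cphi.
have {}q0 : cone_rad q = 0 by apply/eqP; rewrite eq_le q0 cone_rad_ge0.
rewrite q0 expr0n/= in crad2; rewrite /continuous_at q0 expr0n/= mulr0.
apply/(@norm_cvg0P _ _ _ (nbhs q) (nbhs_filter q)).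
have Ccvg : (C * cone_rad p ^+ 2) @[p --> q] --> (0 : R).
  by rewrite -(mulr0 C); apply: (@cvgMr _ _ (nbhs q) (nbhs_filter q)).
apply: (@squeeze_cvgr _ (nbhs q) (nbhs_filter q) _ (fun=> 0)
  (fun p => C * cone_rad p ^+ 2)) => //.
  apply: nearW => p; rewrite normr_ge0/= normrM [X in (_ * X)]ger0_norm ?sqr_ge0//.
  by rewrite ler_wpM2r ?sqr_ge0.
exact: (@cvg_cst _ _ _ (nbhs q) (nbhs_filter q)).
Qed.

End cone_observables.

(** * Calculus along a curve in the cone *)

Section curve_calculus.
Context {R : realType} {d : nat} {T : R}.
Local Notation leb := (@lebesgue_measure R).
Variables (v : R -> 'rV[R]_d -> 'rV[R]_d) (w : R -> 'rV[R]_d -> R).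
Implicit Types (g : cone_curve d T).

Lemma rcurve_le_bound g : exists2 M, 0 <= M & forall t, rcurve g t <= M.
Proof.
have [M gM] := rcurve_bounded g.
exists (Num.max M 0); first by rewrite le_max lexx orbT.
move=> t; rewrite le_max; have [t0|tN] := boolP (t \in `[0, T]); last first.
  by rewrite /rcurve (curve_at_out _ tN) /cone_vertex cone_rad_pt lexx orbT.
have tA : t \in `[0, T]%classic by rewrite inE.
have -> : t = set_val (exist _ t tA : set_type `[0, T]%classic) by [].
by rewrite /rcurve curve_at_val gM.
Qed.

(** The increment of [P] is of the order of the increment of time, so that of [F] is
    of its square. At a zero of the radius, [F] will be [z k] and [P] the distance
    travelled. *)
Lemma is_derive_quadratic_bound (F P : R -> R) (C t p : R) :
  (\forall s \near t, `|F s - F t| <= C * (P s - P t) ^+ 2) ->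
  is_derive t 1 P p -> is_derive t 1 F 0.
Proof.
move=> FP [dP _].
have cP : {for t, continuous P}.
  by apply: differentiable_continuous; exact/derivable1_diffP.
have ht : h + t @[h --> 0^'] --> t.
  rewrite -[X in _ --> X]add0r; apply: cvgD; last exact: cvg_cst.
  exact: cvg_within.
have FP0 : \forall h \near 0^', `|F (h + t) - F t| <= C * (P (h + t) - P t) ^+ 2.
  exact: (ht _ FP).
have qP : h^-1 * (P (h + t) - P t) @[h --> 0^'] --> 'D_1 P t.
  have : h^-1 *: (P (h *: 1 + t) - P t) @[h --> 0^'] --> 'D_1 P t by [].
  by under eq_fun do rewrite -[_ *: 1]/(_ * 1) mulr1.
have qPP : C * (`|h^-1 * (P (h + t) - P t)| * `|P (h + t) - P t|) @[h --> 0^'] -->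
    C * (`|'D_1 P t| * `|P t - P t|).
  apply: cvgMr; apply: cvgM; first exact: cvg_norm.
  apply: cvg_norm; apply: cvgB; last exact: cvg_cst.
  exact: (cvg_comp _ _ ht).
rewrite subrr normr0 !mulr0 in qPP.
suff H : h^-1 * (F (h + t) - F t) @[h --> 0^'] --> (0 : R).
  have H' : h^-1 *: (F (h *: 1 + t) - F t) @[h --> 0^'] --> (0 : R).
    by under eq_fun do rewrite -[_ *: 1]/(_ * 1) mulr1.
  by split; [apply/cvg_ex; exists 0; exact: H'|exact/cvg_lim].
apply/norm_cvg0P; apply: squeeze_cvgr (@cvg_cst _ _ _ _ _) qPP.
apply: filterS FP0 => h FPh; rewrite normr_ge0/= normrM.
apply: (le_trans (ler_wpM2l (normr_ge0 _) FPh)).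
rewrite [in leRHS]normrM -[in leRHS]mulrA -[in leRHS]normrM -expr2.
by rewrite (ger0_norm (sqr_ge0 _)) mulrCA.
Qed.

(** What the product rule sees of a test function: bounded Lipschitz values, and
    a time derivative and a gradient that obey the chain rule. Constants are the
    other instance of interest. *)
Record observable (z zt : R -> 'rV[R]_d -> R) (zx : R -> 'rV[R]_d -> 'rV[R]_d) :
    Prop := {
  observable_bounded : exists2 C, 0 <= C & forall t x, `|z t x| <= C;
  observable_lipschitz : exists2 L, 0 <= L &
    forall s t x y, `|z t y - z s x| <= L * (`|t - s| + enorm (y - x));
  observable_chain : forall (x : R -> 'rV[R]_d) (t : R) u, is_derive t 1 x u ->
    is_derive t 1 (fun s => z s (x s)) (zt t (x t) + dotp (zx t (x t)) u) }.

Lemma unit_observable : observable (fun _ _ => 1) (fun _ _ => 0) (fun _ _ => 0).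
Proof.
split.
- by exists 1 => // t x; rewrite normr1.
- by exists 0 => // s t x y; rewrite subrr normr0 mul0r.
- move=> x t u _; rewrite add0r /dotp big1 => [|i _]; first exact: is_derive_cst.
  by rewrite mxE mul0r.
Qed.

Lemma test_function_observable S zeta : test_function S zeta ->
  observable (fun t x => zeta (t, x)) (time_derivative zeta) (space_gradient zeta).
Proof.
move=> tz; split; [|exact: test_function_lipschitz tz|].
  by have [C C0 zC] := test_function_bounded tz; exists C.
by move=> *; exact: test_function_chain tz _.
Qed.

Section along_a_curve.
Variable g : cone_curve d T.
Hypothesis T0 : 0 < T.
Hypothesis acg : abs_continuous T (curve_at g).

Lemma mdist_le_primitive : exists P : R -> R,
  [/\ continuous P,
   forall s t, 0 <= s -> s <= t -> t <= T ->
     mdist (curve_at g s) (curve_at g t) <= P t - P s &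
   {ae leb, forall t, t \in `]0, T[ -> exists p, is_derive t 1 P p}].
Proof.
have [f fi fg] := acg; have [P [cP fP dP]] := integrable_primitive T0 fi.
exists P; split => //.
  by move=> s t s0 st tT; rewrite -lee_fin -fP// fg.
apply: (ae_imply dP) => t /= dPt t0T.
by exists (f t); exact: dPt.
Qed.

(** Where the radius is positive this is the product rule. Where it vanishes, the
    derivative is [0]: there [z k] is at most a constant times the square of the
    distance to the vertex, and this distance grows at most linearly for almost
    every time since it is dominated by the increments of an almost everywhere
    differentiable function. *)
Lemma observable_derivative z zt zx :
  observable z zt zx -> characteristic v w g ->
  {ae leb, forall t, t \in `]0, T[ ->
    is_derive t 1 (fun s => z s (xcurve g s) * rcurve g s ^+ 2)
      ((zt t (xcurve g t) + dotp (zx t (xcurve g t)) (v t (xcurve g t)) +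
        z t (xcurve g t) * w t (xcurve g t)) * rcurve g t ^+ 2)}.
Proof.
move=> [[C C0 zC] _ zch] chg; have [P [cP gP dP]] := mdist_le_primitive.
apply: (ae_imply2 dP chg) => t /= dPt chgt t0T.
have t0Tc : t \in `[0, T] by exact: subset_itv_oo_cc.
have [r0|r0] := leP (rcurve g t) 0; last first.
  have [dx dk] := chgt t0Tc r0.
  rewrite (_ : _ * _ = z t (xcurve g t) *: (w t (xcurve g t) * rcurve g t ^+ 2) +
    rcurve g t ^+ 2 *:
      (zt t (xcurve g t) + dotp (zx t (xcurve g t)) (v t (xcurve g t)))).
    by apply: is_deriveM => //; exact: zch.
  by rewrite -[_ *: (w _ _ * _)]/(_ * _) -[_ *: (zt _ _ + _)]/(_ * _); ring.
have {}r0 : rcurve g t = 0 by apply/eqP; rewrite eq_le r0 cone_rad_ge0.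
rewrite r0 expr0n mulr0; have [p dPtp] := dPt t0T.
apply: (is_derive_quadratic_bound (C := C) _ dPtp).
have := near_in_itvoo t0T; apply: filterS => s s0T.
rewrite r0 expr0n mulr0 subr0 normrM [X in _ * X]ger0_norm ?sqr_ge0//.
rewrite ler_pM ?sqr_ge0//.
have rs : rcurve g s <= `|P s - P t|.
  have -> : rcurve g s = `|rcurve g s - rcurve g t|.
    by rewrite r0 subr0 ger0_norm// cone_rad_ge0.
  apply: (le_trans (cone_rad_lip _ _)).
  move: s0T t0T; rewrite !in_itv/= => /andP[s0 sT] /andP[t0 tT].
  have [st|/ltW ts] := leP s t.
    by rewrite distrC (le_trans (gP _ _ (ltW s0) st (ltW tT)))// ler_norm.
  by rewrite metric_sym (le_trans (gP _ _ (ltW t0) ts (ltW sT)))// ler_norm.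
by rewrite -[leRHS]real_normK ?num_real// ler_pXn2r ?nnegrE// cone_rad_ge0.
Qed.

(** [z k] is a Lipschitz function of time and of the point of the cone, so it
    inherits the absolute continuity of the curve, including at the times where
    the radius vanishes and the position is not even defined. *)
Lemma observable_FTC z zt zx (a b : R) :
  observable z zt zx -> characteristic v w g ->
  let F t := z t (xcurve g t) * rcurve g t ^+ 2 in
  let f t := (zt t (xcurve g t) + dotp (zx t (xcurve g t)) (v t (xcurve g t)) +
        z t (xcurve g t) * w t (xcurve g t)) * rcurve g t ^+ 2 in
  0 <= a -> a < b -> b <= T ->
  measurable_fun (`[0, T] : set R) f ->
  leb.-integrable `[a, b] (EFin \o f) /\
  (\int[leb]_(t in `[a, b]) (f t)%:E = (F b - F a)%:E)%E.
Proof.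
move=> zz chg F f a0 ab bT mf.
have [[C C0 zC] [L L0 zL] _] := zz.
have [M M0 gM] := rcurve_le_bound g.
have [K K0 FK] := cone_observable_lipschitz C0 L0 M0 zC zL.
have [m mi mg] := acg.
have abT : `[a, b] `<=` `[0, T] by apply: subset_itv; rewrite bnd_simp.
have im : leb.-integrable `[a, b] (EFin \o m) by exact: integrableS mi.
have fin_ab s t : a <= s -> t <= b -> leb.-integrable `[s, t] (EFin \o m).
  by move=> as_ tb; apply: integrableS im => //; apply: subset_itv; rewrite bnd_simp.
have i1 s t : leb.-integrable `[s, t] (EFin \o cst (1 : R)).
  apply: continuous_compact_integrable; first exact: segment_compact.
  by apply: continuous_subspaceT => x; exact: cvg_cst.
apply: (@absolutely_continuous_FTC R F f (fun t => K * (1 + m t))) => //.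
- rewrite (_ : _ \o _ =
    (fun t => K%:E * ((EFin \o cst (1%R : R)) t + (EFin \o m) t))%E); last first.
    by apply/funext => t /=; rewrite EFinM EFinD.
  by apply: integrableZl => //; apply: integrableD => //; exact: i1.
- move=> s t as_ st tb.
  have -> : (\int[leb]_(u in `[s, t]) (K * (1 + m u))%:E =
    K%:E * ((t - s)%:E + \int[leb]_(u in `[s, t]) (m u)%:E))%E.
    under eq_integral do rewrite EFinM EFinD.
    rewrite integralZl//; last first.
      by apply: (integrableD _ (i1 s t)) => //; exact: fin_ab.
    rewrite (integralD _ (i1 s t))//; last exact: fin_ab.
    congr (_ * (_ + _))%E.
    rewrite [LHS](@integral_cst _ _ _ leb `[s, t] _ 1)// mul1e.
    have : (@lebesgue_measure R) `[s, t]%classic = (t - s)%:E.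
      rewrite lebesgue_measure_itv/= lte_fin; case: ltP => // ts.
      by rewrite (@le_anti _ _ s t) ?st// subrr.
    exact.
  have s0 := le_trans a0 as_; have tT := le_trans tb bT.
  have := FK s t (curve_at g s) (curve_at g t) (gM s) (gM t).
  rewrite -lee_fin => /le_trans; apply.
  rewrite EFinM EFinD lee_wpmul2l ?lee_fin// leeD//.
    by rewrite lee_fin ger0_norm// subr_ge0.
  exact: mg.
- exact: measurable_funS mf.
- apply: (ae_imply (observable_derivative zz chg)) => t /= dt abt.
  apply: dt; move: abt; rewrite !in_itv/= => /andP[at_ tb].
  by rewrite (le_lt_trans a0)// (lt_le_trans tb).
Qed.

End along_a_curve.
End curve_calculus.

(** * Joint measurability in time and curve *)

Section caratheodory.
Context {R : realType}.

(** A function that is measurable in [x] and continuous in [t] is the limit of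
    its values at the grid points [j / (n + 1)] to the left of [t]. For targets
    that are merely pseudometric, the open set [U] is exhausted by the closed sets
    of points that avoid the interior of every ball of radius [1 / (k + 1)] centred
    off [U]. *)
Lemma caratheodory_measurable_preimage (M : pseudoMetricType R) dX
    (X : measurableType dX) (f : R -> X -> M) (T : R) (U : set M) :
  (forall t (V : set M), open V -> measurable [set x | V (f t x)]) ->
  (forall x, {within `[0, T], continuous (f^~ x)}) ->
  open U ->
  measurable [set p : measurableTypeR R * X | p.1 \in `[0, T] /\ U (f p.1 p.2)].
Proof.
move=> mf cf oU.
pose W (k : nat) : set M := \bigcup_(q in ~` U) (ball q (@harmonic R k))°.
have oW k : open (W k) by apply: bigcup_open => q _; exact: open_interior.
pose slab n (j : nat) : set R :=
  `[0, T] `&` `[j%:R * @harmonic R n, (j%:R + 1) * @harmonic R n[.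
pose B (k n : nat) : set (measurableTypeR R * X) :=
  \bigcup_j (slab n j `*` [set x | (~` W k) (f (j%:R * @harmonic R n) x)]).
have mB k n : measurable (B k n).
  apply: bigcup_measurable => j _; apply: measurableX.
    by apply: measurableI; exact: measurable_itv.
  rewrite (_ : [set x | _] = ~` [set x | W k (f (j%:R * @harmonic R n) x)])//.
  by apply: measurableC; apply: mf.
suff -> : [set p : measurableTypeR R * X | p.1 \in `[0, T] /\ U (f p.1 p.2)] =
    \bigcup_k \bigcup_N \bigcap_(n in [set n | (N <= n)%N]) B k n.
  apply: bigcup_measurable => k _; apply: bigcup_measurable => N _.
  by apply: bigcap_measurable => [|n _ //]; exists N => /=.
have h0 n : 0 < @harmonic R n by exact: harmonic_gt0.
have hsmall (e : R) : 0 < e -> exists N, forall n, (N <= n)%N -> @harmonic R n < e.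
  move=> e0; have /cvgrPdist_lt/(_ e e0)[N _ HN] := @cvg_harmonic R.
  by exists N => n /HN /=; rewrite sub0r normrN ger0_norm// ltW.
have cfx x t : t \in `[0, T] -> forall V : set M, nbhs (f t x) V ->
    exists N, forall n, (N <= n)%N -> forall j, slab n j t ->
      V (f (j%:R * @harmonic R n) x).
  move=> t0T V; have /subspace_continuousP/(_ t t0T) cxt := cf x.
  move=> /cxt Vf.
  have {Vf}/nbhs_ballP[e /= e0 eV] : nbhs t [set s | `[0, T]%classic s -> V (f s x)].
    exact: Vf.
  have [N HN] := hsmall e e0; exists N => n /HN he j [].
  rewrite /= !in_itv/= => /andP[_ tT] /andP[jt tj].
  apply: eV; last first.
    by rewrite /= in_itv/= (le_trans jt tT) mulr_ge0// ltW.
  rewrite /ball/= ger0_norm ?subr_ge0// ltrBlDl (lt_trans tj)//.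
  by rewrite mulrDl mul1r ltrD2l.
have slab_ex n t : t \in `[0, T] -> exists j, slab n j t.
  move=> t0T; have t0 : 0 <= t by move: t0T; rewrite in_itv/= => /andP[].
  exists (Num.truncn (t / @harmonic R n)); split => //.
  have /andP[] := truncn_itv (divr_ge0 t0 (ltW (h0 n))).
  rewrite ler_pdivlMr// ltr_pdivrMr// -natr1 => jt tj.
  by apply/andP; split.
apply/seteqP; split=> [[t x] /= [t0T Utx]|[t x] [k _ [N _ BN]] /=].
- have /nbhs_ballP[e /= e0 eU] : nbhs (f t x) U by exact: open_nbhs_nbhs.
  have e20 : 0 < e / 2 by rewrite divr_gt0.
  have [k _ ke] : exists2 k, True & @harmonic R k <= e / 2.
    by have [N HN] := hsmall _ e20; exists N => //; rewrite ltW// HN.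
  exists k => //; have [N HN] := cfx x t t0T _ (nbhsx_ballx (f t x) (e / 2) e20).
  exists N => // n Nn; have [j tj] := slab_ex n t t0T.
  exists j => //; split => //= -[q Uq] /interior_subset qf.
  apply: Uq; apply: eU; apply: (@ball_split _ _ (f (j%:R * @harmonic R n) x)).
    exact: HN tj.
  by apply: ball_sym; apply: le_ball qf.
- have t0T : t \in `[0, T].
    by have [j _ [[t0T _] _]] := BN N (leqnn N).
  split => //; apply: contrapT => Utx.
  have [N' HN'] := cfx x t t0T _ (nbhs_interior (nbhsx_ballx (f t x) _ (h0 k))).
  have [j _ [/= tj Wj]] := BN (maxn N N') (leq_maxl _ _).
  by apply: Wj; exists (f t x) => //; exact: HN' (leq_maxr _ _) _ tj.
Qed.

Lemma caratheodory_measurable_fun dX (X : measurableType dX) (f : R -> X -> R)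
    (T : R) :
  (forall t, measurable_fun setT (f t)) ->
  (forall x, {within `[0, T], continuous (f^~ x)}) ->
  @measurable_fun _ _ (measurableTypeR R * X)%type R (`[0, T] `*` setT)
    (fun p => f p.1 p.2).
Proof.
move=> mf cf.
apply: (measurability _ (measurable_realfun.RGenOInfty.measurableE R)).
move=> _ [_ [a ->] <-].
have mf' t (V : set R) : open V -> measurable [set x | V (f t x)].
  move=> oV; rewrite -[X in measurable X]setTI; apply: mf => //.
  exact: open_measurable.
have := caratheodory_measurable_preimage mf' cf (rray_open a).
rewrite (_ : [set p | _] =
  (`[0, T] `*` setT) `&` ((fun p => f p.1 p.2) @^-1` `]a, +oo[)); first exact.
apply/seteqP; split => [[t x] /= [t0T ft]|[t x] /= [[t0T _] ft]] //.
Qed.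

(** [R] and [measurableTypeR R] have the same measurable sets but are different
    structures, and Lebesgue measure lives on the second one. *)
Lemma measurable_time_id : @measurable_fun _ _ (measurableTypeR R) R setT id.
Proof. by move=> _ Y mY; rewrite setTI. Qed.

Lemma measurable_fun_time dX dY (X : measurableType dX) (Y : measurableType dY)
    (D : set (R * X)) (f : R * X -> Y) : measurable D ->
  measurable_fun D f -> @measurable_fun _ _ (measurableTypeR R * X)%type Y D f.
Proof.
move=> mD mf _ B mB.
have mid : @measurable_fun _ _ (measurableTypeR R * X)%type (R * X)%type setT
    (fun p => (p.1, p.2)).
  apply: measurable_fun_pair; last exact: measurable_snd.
  exact: (measurableT_comp measurable_time_id measurable_fst).
rewrite (_ : D `&` _ = setT `&` (fun p => (p.1, p.2)) @^-1` (D `&` f @^-1` B)).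
  by apply: mid => //; exact: mf.
by rewrite setTI; apply/seteqP; split => -[].
Qed.

End caratheodory.

Section borel_functions.
Context {R : realType} {d : nat}.

Lemma continuous_rV_measurable (f : 'rV[R]_d -> R) : continuous f ->
  measurable_fun setT f.
Proof.
move=> cf; apply: (measurability _ (measurable_realfun.RGenOInfty.measurableE R)).
move=> _ [_ [a ->] <-].
rewrite setTI; apply: sub_sigma_algebra; apply: open_comp => // x _; exact: cf.
Qed.

Lemma continuous_enorm : continuous (@enorm R d).
Proof.
move=> x; apply: (@continuous_comp _ _ _ (fun x : 'rV[R]_d => dotp x x) Num.sqrt).
  suff : dotp y y @[y --> x] --> dotp x x by [].
  rewrite /dotp.
  apply: (@cvg_big _ _ _ _ xpredT _ _ (nbhs x) _ _ _ (nbhs_filter x)) => [|i _].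
    exact: add_continuous.
  by apply: (@cvgM _ _ (nbhs x) (nbhs_filter x)); exact: coord_continuous.
exact: sqrt_continuous.
Qed.

(** The product sigma-algebra is not a priori the Borel one of the product, hence
    the detour through separate regularity in time and space. *)
Lemma continuous_spacetime_measurable (f : R * 'rV[R]_d -> R) (T : R) :
  continuous f ->
  @measurable_fun _ _ (measurableTypeR R * 'rV[R]_d)%type R (`[0, T] `*` setT)
    (fun p => f (p.1, p.2)).
Proof.
move=> cf; apply: (@caratheodory_measurable_fun R _ 'rV[R]_d (fun t x => f (t, x))).
  move=> t; apply: continuous_rV_measurable => x.
  apply: (@continuous_comp _ _ _ (fun x => (t, x)) f); last exact: cf.
  have tx : (fun=> t) @ x --> t by exact: (@cvg_cst _ _ _ (nbhs x) (nbhs_filter x)).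
  have xx : (fun y : 'rV[R]_d => y) @ x --> x by exact: cvg_id.
  exact: (cvg_pair tx xx).
move=> x; apply: continuous_subspaceT => t.
apply: (@continuous_comp _ _ _ (fun t => (t, x)) f); last exact: cf.
have tx : (fun=> x) @ t --> x by exact: (@cvg_cst _ _ _ (nbhs t) (nbhs_filter t)).
have tt : (fun s : R => s) @ t --> t by exact: cvg_id.
exact: (cvg_pair tt tx).
Qed.

End borel_functions.

Section joint_measurability.
Context {R : realType} {d : nat} {T : R}.
Implicit Types (U : set (cone R d)).

Let RC := (measurableTypeR R * cone_curve d T)%type.

Lemma measurable_curve_preimage U : open U ->
  measurable [set p : RC | p.1 \in `[0, T] /\ U (curve_at p.2 p.1)].
Proof.
move=> oU.
apply: (@caratheodory_measurable_preimage R (cone R d) _ (cone_curve d T)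
  (fun t g => curve_at g t) T U) => // [t V oV|g].
  apply: open_curve_measurable.
  apply: (open_comp (f := fun g => curve_at g t)) => // g _.
  exact: curve_at_continuous.
exact: curve_at_within.
Qed.

Lemma rcurve_out (g : cone_curve d T) t : t \notin `[0, T] -> rcurve g t = 0.
Proof. by move=> tN; rewrite /rcurve curve_at_out// cone_rad_pt. Qed.

Lemma measurable_rcurve_joint :
  @measurable_fun _ _ RC R setT (fun p => rcurve p.2 p.1).
Proof.
apply: (measurability _ (measurable_realfun.RGenOInfty.measurableE R)).
move=> _ [_ [a ->] <-].
rewrite setTI; have [a0|a0] := ltP a 0.
  rewrite (_ : _ @^-1` _ = setT)//; apply/seteqP; split => // p _ /=.
  by rewrite in_itv/= andbT (lt_le_trans a0)// cone_rad_ge0.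
have oU : open [set q : cone R d | `]a, +oo[%classic (cone_rad q)].
  by apply: open_comp => // q _; exact: cone_rad_continuous.
rewrite (_ : _ @^-1` _ = [set p : RC | p.1 \in `[0, T] /\
    `]a, +oo[%classic (cone_rad (curve_at p.2 p.1))]).
  exact: measurable_curve_preimage oU.
apply/seteqP; split => -[t g] /= => [ar|[]//]; split => //.
apply/negPn/negP => tN; move: ar; rewrite in_itv/= andbT rcurve_out//.
by rewrite ltNge a0.
Qed.

(** The position is continuous only off the vertex, and at the vertex it takes a
    fixed conventional value; both pieces have measurable preimages. *)
Lemma measurable_xcurve_joint :
  @measurable_fun _ _ RC 'rV[R]_d setT (fun p => xcurve p.2 p.1).
Proof.
apply: (@measurability _ _ _ _ _ _ (@open 'rV[R]_d)) => // _ [V oV <-].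
rewrite setTI.
have oU : open [set q : cone R d | 0 < cone_rad q /\ V (cone_pos q)].
  apply/interior_id/seteqP; split; first exact: interior_subset.
  move=> q [q0 Vq]; apply: filterI.
    exact: (cvgr_gt (cone_rad q) (@cone_rad_continuous R d q)).
  by apply: (cone_pos_continuous q0); exact: open_nbhs_nbhs.
have pos_in t (g : cone_curve d T) : 0 < rcurve g t -> t \in `[0, T].
  by move=> r0; apply/negPn/negP => /(rcurve_out g) r0'; rewrite r0' ltxx in r0.
have vertex t (g : cone_curve d T) : ~ 0 < rcurve g t ->
    xcurve g t = cone_pos (cone_vertex : cone R d).
  move=> /negP; rewrite -leNgt => r0; apply: xcurve_vertex.
  by apply/eqP; rewrite eq_le r0 cone_rad_ge0.
have mpos : measurable [set p : RC | 0 < rcurve p.2 p.1].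
  rewrite (_ : [set p | _] =
      setT `&` (fun p : RC => rcurve p.2 p.1) @^-1` `]0, +oo[).
    by apply: measurable_rcurve_joint.
  by rewrite setTI; apply/seteqP; split => p /=; rewrite in_itv/= andbT.
have [V0|V0] := pselect (V (cone_pos (cone_vertex : cone R d))).
  rewrite (_ : _ @^-1` V = [set p : RC | p.1 \in `[0, T] /\
      [set q : cone R d | 0 < cone_rad q /\ V (cone_pos q)] (curve_at p.2 p.1)] `|`
      ~` [set p : RC | 0 < rcurve p.2 p.1]).
    apply: measurableU; first exact: measurable_curve_preimage oU.
    exact: measurableC.
  apply/seteqP; split => -[t g] /=.
    move=> Vx; have [r0|] := pselect (0 < rcurve g t); last by right.
    by left; split; [exact: pos_in r0|].
  by move=> [[_ []//]|/vertex ->].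
rewrite (_ : _ @^-1` V = [set p : RC | p.1 \in `[0, T] /\
      [set q : cone R d | 0 < cone_rad q /\ V (cone_pos q)] (curve_at p.2 p.1)]).
  exact: measurable_curve_preimage oU.
apply/seteqP; split => -[t g] /=; last by case=> _ [].
move=> Vx; have [r0|/vertex xE] := pselect (0 < rcurve g t).
  by split; [exact: pos_in r0|].
by rewrite xE in Vx.
Qed.

End joint_measurability.

(** * Superposition of the curves *)

Section superposition.
Context {R : realType} {d : nat} {T : R}.
Local Notation leb := (@lebesgue_measure R).
Local Notation TX := (measurableTypeR R * 'rV[R]_d)%type.
Local Notation TC := (measurableTypeR R * cone_curve d T)%type.
Local Notation slab := (`[0, T] `*` [set: 'rV[R]_d] : set TX).

Lemma measurable_slab : measurable slab.
Proof. by apply: measurableX; [exact: measurable_itv|exact: measurableT]. Qed.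

Lemma measurable_restrict_slab (A : R -> 'rV[R]_d -> R) :
  measurable_fun slab (fun p => A p.1 p.2) ->
  measurable_fun [set: TX] ((fun p => A p.1 p.2) \_ slab).
Proof. by move=> mA; exact/(measurable_restrictT _ measurable_slab). Qed.

(** Since the radius is [0] outside [[0, T]], the product does not change when [A]
    is set to [0] there; this makes it measurable on the whole space. *)
Lemma measurable_along_curves (A : R -> 'rV[R]_d -> R) :
  measurable_fun slab (fun p => A p.1 p.2) ->
  measurable_fun [set: TC]
    (fun p => A p.1 (xcurve p.2 p.1) * rcurve p.2 p.1 ^+ 2).
Proof.
move=> mA.
have mA' := measurable_restrict_slab mA.
rewrite (_ : (fun p => _) = (fun p : TC =>
    ((fun p => A p.1 p.2) \_ slab) (p.1, xcurve p.2 p.1) * rcurve p.2 p.1 ^+ 2)).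
  apply: measurable_funM; last first.
    by apply: measurable_funX; exact: measurable_rcurve_joint.
  apply: (measurableT_comp mA').
  apply: measurable_fun_pair; first exact: measurable_fst.
  exact: measurable_xcurve_joint.
apply/funext => -[t g] /=; rewrite patchE.
case: ifPn => //; rewrite notin_setE /= => tN.
by rewrite rcurve_out ?expr0n ?mulr0//; apply/negP => t0T; exact: tN.
Qed.

Lemma measurable_at_time (A : R -> 'rV[R]_d -> R) t : t \in `[0, T] ->
  measurable_fun slab (fun p => A p.1 p.2) -> measurable_fun setT (A t).
Proof.
move=> t0T mA.
have := measurable_fun_pair2 (t : measurableTypeR R) (measurable_restrict_slab mA).
by apply: eq_measurable_fun => x _; rewrite patchE mem_set.
Qed.

Local Open Scope ereal_scope.

(** The change of variables for nonnegative integrands, applied to the positive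
    and to the negative part: the weight [r^2 >= 0] commutes with taking them. *)
Lemma integral_h2_signed (eta : {measure set (cone_curve d T) -> \bar R}) (t : R)
    (f : 'rV[R]_d -> R) : measurable_fun setT f ->
  \int[h2 eta t]_x (f x)%:E = \int[eta]_g (f (xcurve g t) * rcurve g t ^+ 2)%:E.
Proof.
move=> mf; have mEf : measurable_fun setT (EFin \o f) by exact/measurable_EFinP.
rewrite integralE [RHS]integralE; congr (_ - _).
  rewrite integral_h2//; last exact: measurable_funepos.
  apply: eq_integral => g _; rewrite !funeposE.
  by rewrite EFinM maxe_pMl// ?lee_fin ?sqr_ge0// mul0e.
rewrite integral_h2//; last exact: measurable_funeneg.
apply: eq_integral => g _; rewrite !funenegE.
by rewrite [(f _ * _)%:E]EFinM -mulNe maxe_pMl// ?lee_fin ?sqr_ge0// mul0e.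
Qed.

Variables (v : R -> 'rV[R]_d -> 'rV[R]_d) (w : R -> 'rV[R]_d -> R).
Hypothesis T0 : (0 < T)%R.
Hypothesis mv : measurable_fun slab (fun p => v p.1 p.2).
Hypothesis mw : measurable_fun slab (fun p => w p.1 p.2).

Definition rate t x : R := (1 + enorm (v t x) + `|w t x|)%R.

Lemma rate_ge0 t x : (0 <= rate t x)%R.
Proof. by rewrite !addr_ge0// enorm_ge0. Qed.

Lemma measurable_rate : measurable_fun slab (fun p => rate p.1 p.2).
Proof.
apply: measurable_funD; last exact: measurableT_comp.
apply: measurable_funD; first exact: measurable_cst.
by apply: measurableT_comp mv; apply: continuous_rV_measurable; exact: continuous_enorm.
Qed.

Let measurable_rate_curves := measurable_along_curves measurable_rate.

Let rate_out (t : R) (g : cone_curve d T) : t \notin `[0, T]%R ->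
  (rate t (xcurve g t) * rcurve g t ^+ 2)%:E = 0.
Proof. by move=> tN; rewrite rcurve_out// expr0n mulr0. Qed.

Definition action (g : cone_curve d T) : \bar R :=
  \int[leb]_(t in `[0%R, T]) (rate t (xcurve g t) * rcurve g t ^+ 2)%:E.

Lemma action_ge0 g : 0 <= action g.
Proof. by apply: integral_ge0 => t _; rewrite lee_fin mulr_ge0 ?rate_ge0 ?sqr_ge0. Qed.

Lemma integral_restrict_time (f : R -> \bar R) :
  (forall t, t \notin `[0%R, T] -> f t = 0) ->
  \int[leb]_(t in `[0%R, T]) f t = \int[leb]_t f t.
Proof.
move=> f0; rewrite integral_mkcond; apply: eq_integral => t _.
rewrite patchE; case: ifPn => //; rewrite notin_setE /= => tN.
by rewrite f0//; exact/negP.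
Qed.

Lemma actionE g :
  action g = \int[leb]_t (rate t (xcurve g t) * rcurve g t ^+ 2)%:E.
Proof. by apply: integral_restrict_time => t; exact: rate_out. Qed.

Lemma measurable_action : measurable_fun setT action.
Proof.
rewrite (_ : action = fun g =>
    \int[leb]_t (rate t (xcurve g t) * rcurve g t ^+ 2)%:E); last first.
  by apply/funext => g; exact: actionE.
apply: (@measurable_fun_fubini_tonelli_G _ _ (measurableTypeR R) (cone_curve d T) R
  leb
  (fun p : TC => (rate p.1 (xcurve p.2 p.1) * rcurve p.2 p.1 ^+ 2)%:E)).
  exact/measurable_EFinP.
by move=> p; rewrite lee_fin mulr_ge0 ?rate_ge0 ?sqr_ge0.
Qed.

Lemma measurable_along_curve (A : R -> 'rV[R]_d -> R) (g : cone_curve d T) :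
  measurable_fun slab (fun p => A p.1 p.2) ->
  @measurable_fun _ _ (measurableTypeR R) R `[0%R, T]
    (fun t => (A t (xcurve g t) * rcurve g t ^+ 2)%R).
Proof.
move=> mA; apply: measurable_funTS.
exact: measurable_fun_pair1 g (measurable_along_curves mA).
Qed.

(** The squared radius [k] satisfies [k(t) <= k(s) + \int |w| k]. Averaging over
    [s] replaces [k(s)] by a time integral, the only kind of quantity on which
    there is a bound that is integrable over the curves. *)
Lemma rcurve_sqr_le_action (g : cone_curve d T) t :
  abs_continuous T (curve_at g) -> characteristic v w g -> t \in `[0%R, T] ->
  (rcurve g t ^+ 2)%:E <= ((1 + T) / T)%:E * action g.
Proof.
move=> acg chg t0T.
have mk : @measurable_fun _ _ (measurableTypeR R) R `[0%R, T]
    (fun s => rcurve g s ^+ 2)%R.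
  apply: measurable_funTS; apply: measurable_funX.
  exact: (measurable_fun_pair1 g measurable_rcurve_joint).
have mwk := measurable_along_curve g mw.
(* [w k] in the form in which the calculus along curves produces it for [z = 1]. *)
pose f s : R :=
  ((0 + dotp 0 (v s (xcurve g s)) + 1 * w s (xcurve g s)) * rcurve g s ^+ 2)%R.
have fE s : f s = (w s (xcurve g s) * rcurve g s ^+ 2)%R.
  by rewrite /f /dotp big1 ?addr0 ?add0r ?mul1r// => i _; rewrite mxE mul0r.
have mf : @measurable_fun _ _ (measurableTypeR R) R `[0%R, T] f.
  by apply: eq_measurable_fun mwk => s _; rewrite fE.
pose W := \int[leb]_(s in `[0%R, T]) `|(f s)%:E|.
have step a b : (0 <= a)%R -> (a < b)%R -> (b <= T)%R ->
    `|(rcurve g b ^+ 2 - rcurve g a ^+ 2)%:E| <= W.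
  move=> a0 ab bT.
  have [if_ <-] : leb.-integrable `[a, b] (EFin \o f) /\
     \int[leb]_(t in `[a, b]) (f t)%:E = (rcurve g b ^+ 2 - rcurve g a ^+ 2)%:E.
    have := observable_FTC T0 acg unit_observable chg a0 ab bT mf.
    by rewrite !mul1r.
  have mfab : measurable_fun `[a, b] (EFin \o f) by exact: measurable_int if_.
  apply: le_trans (le_abse_integral leb _ mfab) _ => //.
  apply: ge0_subset_integral => //; last by apply: subset_itv; rewrite bnd_simp.
  by apply: measurableT_comp => //; exact/measurable_EFinP.
have kW s : s \in `[0%R, T] -> (rcurve g t ^+ 2)%:E <= (rcurve g s ^+ 2)%:E + W.
  move: t0T; rewrite !in_itv/= => /andP[t0 tT] /andP[s0 sT].
  rewrite -leeBlDl// -EFinB; apply: le_trans (lee_abs _) _.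
  have [st|ts|->] := ltgtP s t.
  - exact: step.
  - by rewrite /= distrC; exact: step.
  - by rewrite subrr abse0 integral_ge0.
have lebT : (@lebesgue_measure R) `[0%R, T] = T%:E.
  by rewrite lebesgue_measure_itv/= lte_fin T0 sube0.
have intc (c : \bar R) : \int[leb]_(s in `[0%R, T]) cst c s = c * T%:E.
  by rewrite integral_cst//; congr (_ * _); exact: lebT.
have intk : (rcurve g t ^+ 2)%:E * T%:E <= action g + action g * T%:E.
  rewrite -intc.
  have mW : measurable_fun (`[0%R, T] : set (measurableTypeR R)) (cst W).
    exact: measurable_cst.
  have W0 : 0 <= W by exact: integral_ge0.
  have mEk : measurable_fun (`[0%R, T] : set (measurableTypeR R))
      (fun s => (rcurve g s ^+ 2)%:E) by exact/measurable_EFinP.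
  apply: (@le_trans _ _
    (\int[leb]_(s in `[0%R, T]) ((rcurve g s ^+ 2)%:E + cst W s))).
    apply: ge0_le_integral => //=.
    - by move=> s _; rewrite lee_fin sqr_ge0.
    - exact: emeasurable_funD mEk mW.
  rewrite ge0_integralD//; last by move=> s _; rewrite lee_fin sqr_ge0.
  rewrite intc.
  have mact : measurable_fun (`[0%R, T] : set (measurableTypeR R))
      (fun s => (rate s (xcurve g s) * rcurve g s ^+ 2)%:E).
    by apply/measurable_EFinP; exact: measurable_along_curve measurable_rate.
  apply: leeD.
    apply: ge0_le_integral => //.
    - by move=> s _; rewrite lee_fin sqr_ge0.
    - move=> s _; rewrite lee_fin ler_peMl ?sqr_ge0//.
      by rewrite /rate -addrA lerDl addr_ge0 ?enorm_ge0.
  apply: lee_wpmul2r; first by rewrite lee_fin ltW.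
  apply: ge0_le_integral => //.
  - by apply: measurableT_comp => //; exact/measurable_EFinP.
  - move=> s _; rewrite fE abse_EFin lee_fin normrM (ger0_norm (sqr_ge0 _)).
    by rewrite ler_wpM2r ?sqr_ge0// /rate lerDr addr_ge0 ?enorm_ge0.
rewrite (_ : ((1 + T) / T)%:E = T^-1%:E * (1 + T)%:E); last first.
  by rewrite -EFinM mulrC.
rewrite -muleA lee_pdivlMl// muleC; apply: le_trans intk _.
rewrite (muleC (action g)) EFinD ge0_muleDl ?lee_fin ?ler01 ?(ltW T0)//.
by rewrite mul1e.
Qed.

Variable eta : {finite_measure set (cone_curve d T) -> \bar R}.
Hypothesis good : eta.-negligible
  (~` [set g | AC2 T (curve_at g) /\ characteristic v w g]).
Hypothesis finite_action :
  \int[leb]_(t in `[0%R, T]) \int[h2 eta t]_x (rate t x)%:E < +oo.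

Lemma integral_h2_time (A : R -> 'rV[R]_d -> R) :
  measurable_fun slab (fun p => A p.1 p.2) ->
  \int[leb]_(t in `[0%R, T]) \int[h2 eta t]_x (A t x)%:E =
  \int[leb]_t \int[eta]_g (A t (xcurve g t) * rcurve g t ^+ 2)%:E.
Proof.
move=> mA; rewrite -integral_restrict_time => [|t tN]; last first.
  by rewrite integral0_eq// => g _; rewrite rcurve_out// expr0n mulr0.
apply: eq_integral => t; rewrite inE => t0T.
by rewrite integral_h2_signed//; exact: measurable_at_time mA.
Qed.

Lemma integral_action : \int[eta]_g action g < +oo.
Proof.
move: finite_action; rewrite (integral_h2_time measurable_rate).
rewrite (@fubini_tonelli _ _ (measurableTypeR R) (cone_curve d T) R leb eta
  (fun p : TC => (rate p.1 (xcurve p.2 p.1) * rcurve p.2 p.1 ^+ 2)%:E)).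
- by under eq_integral do rewrite -actionE.
- exact/measurable_EFinP.
- by move=> p; rewrite lee_fin mulr_ge0 ?rate_ge0 ?sqr_ge0.
Qed.

Lemma integrable_action : eta.-integrable setT action.
Proof.
apply/integrableP; split; first exact: measurable_action.
by under eq_integral do rewrite gee0_abs ?action_ge0//; exact: integral_action.
Qed.

(** The action is finite for almost every curve, and its real part provides a
    dominating function that serves all times at once. *)
Lemma ae_rcurve_sqr_le : exists D : cone_curve d T -> R,
  [/\ eta.-integrable setT (EFin \o D), (forall g, 0 <= D g)%R &
   {ae eta, forall g, forall t, (rcurve g t ^+ 2 <= D g)%R}].
Proof.
have c0 : (0 <= (1 + T) / T)%R by rewrite divr_ge0 ?addr_ge0// ltW.
exists (fun g => (1 + T) / T * fine (action g))%R; split.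
- apply: (@le_integrable _ _ _ eta setT measurableT _
    (fun g => ((1 + T) / T)%:E * action g)).
  + apply/measurable_EFinP; apply: measurable_funM => //.
    by apply: measurableT_comp measurable_action; exact: fine_measurable.
  + move=> g _ /=; have := action_ge0 g; case: (action g) => [r| |] //= _.
    by rewrite mulr0 normr0 abse_ge0.
  + by apply: integrableZl => //; exact: integrable_action.
- by move=> g; rewrite mulr_ge0 ?fine_ge0 ?action_ge0.
have fin := integrable_ae measurableT integrable_action.
apply: (ae_imply2 good fin) => g /= [[acg _] chg] /(_ I) fing t.
have [t0T|tN] := boolP (t \in `[0%R, T]).
  by rewrite -lee_fin [leRHS]EFinM fineK// rcurve_sqr_le_action.
by rewrite rcurve_out// expr0n/= mulr_ge0 ?fine_ge0 ?action_ge0.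
Qed.

(** Dominated convergence: along each curve [phi(x) r^2] is continuous in time, and
    it is at most a constant times the dominating function of the squared radius. *)
Lemma superposition_narrowly_continuous : narrowly_continuous T (h2 eta).
Proof.
have [D [iD D0 kD]] := ae_rcurve_sqr_le.
split=> [t t0T|phi cphi [C phiC]].
  rewrite /=/h2; have /integrableP[mD] := iD; apply: le_lt_trans.
  apply: ae_ge0_le_integral => //.
  - by move=> g _; rewrite lee_fin mulr_ge0 ?sqr_ge0.
  - apply/measurable_EFinP; under eq_fun do rewrite indicT mul1r.
    by apply: measurable_funX; exact: measurable_rcurve.
  - exact: measurableT_comp.
  apply: (ae_imply kD) => g kg _.
  by rewrite indicT mul1r lee_fin ger0_norm.
have C0 : (0 <= C)%R by apply: le_trans (phiC 0%R).
pose psi (q : cone R d) : R := (phi (cone_pos q) * cone_rad q ^+ 2)%R.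
have cpsi : continuous psi by exact: continuous_cone_observable phiC.
(* Clamping the time extends the integrand to an open interval, of which the end
   points [0] and [T] become interior points. *)
pose f (s : R) (g : cone_curve d T) : R := psi (curve_at g (clamp 0 T s)).
have fE s g :
  f s g = (phi (xcurve g (clamp 0 T s)) * rcurve g (clamp 0 T s) ^+ 2)%R by [].
have mf s : measurable_fun setT (f s).
  apply: measurable_funM; last by apply: measurable_funX; exact: measurable_rcurve.
  apply: (measurableT_comp (continuous_rV_measurable cphi)); exact: measurable_xcurve.
have fD s : {ae eta, forall g, setT g -> `|f s g| <= C * D g}%R.
  apply: (ae_imply kD) => g kg _.
  by rewrite fE normrM (ger0_norm (sqr_ge0 _)) ler_pM ?sqr_ge0.
have iCD : eta.-integrable setT (EFin \o (fun g => C * D g)%R).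
  by rewrite (_ : _ \o _ = fun g => C%:E * (EFin \o D) g)//; exact: integrableZl.
have if_ s : `](-1)%R, (T + 1)%R[%classic s -> eta.-integrable setT (EFin \o f s).
  move=> _; apply/integrableP; split; first exact/measurable_EFinP.
  have /integrableP[mCD] := iCD; apply: le_lt_trans; apply: ae_ge0_le_integral => //.
  - by apply: measurableT_comp => //; exact/measurable_EFinP.
  - exact: measurableT_comp.
  apply: (ae_imply (fD s)) => g + _ => /(_ I) fg.
  by rewrite /= lee_fin (le_trans fg)// ler_norm.
have cf : {ae eta, forall g, setT g ->
    {in `](-1)%R, (T + 1)%R[%classic, continuous (f^~ g)}}.
  apply: aeW => g _ s _.
  have cg := @curve_at_within R d T g.
  have cpg : {within `[0%R, T], continuous (psi \o curve_at g)}.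
    by move=> u; exact: (continuous_comp (cg u) (cpsi _)).
  exact: (clamp_continuous (ltW T0) cpg).
have := continuity_under_integral measurableT if_ cf iCD (fun s _ => fD s).
move=> cF.
apply: (@subspace_eq_continuous _ _ _ (fun s => \int[eta]_(g in setT) f s g)%R).
  move=> s; rewrite inE/= => s0T; congr fine.
  rewrite integral_h2_signed; last exact: continuous_rV_measurable.
  by apply: eq_integral => g _; rewrite fE clamp_id.
apply: continuous_in_subspaceT => s; rewrite inE/= in_itv/= => /andP[s0 sT].
apply: cF; rewrite inE/= in_itv/=; apply/andP; split.
  by rewrite (lt_le_trans _ s0)// ltrN10.
by rewrite (le_lt_trans sT)// ltrDl.
Qed.

(** Fubini's theorem exchanges the integrals over times and curves. Along almost
    every curve the inner integral is the increment of [zeta(t, x(t)) k(t)] over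
    [[0, T]], which vanishes because [zeta] does at both ends. *)
Lemma superposition_equation : reaction_continuity_equation T v w (h2 eta).
Proof.
move=> zeta tz.
pose A t x := (time_derivative zeta t x + dotp (space_gradient zeta t x) (v t x) +
       zeta (t, x) * w t x)%R.
have mA : measurable_fun slab (fun p => A p.1 p.2).
  have mD u := @continuous_spacetime_measurable R d _ T (test_function_partial u tz).2.
  apply: measurable_funD; first apply: measurable_funD.
  - by apply: eq_measurable_fun (mD (1, 0)%R) => p _; rewrite time_derivativeE.
  - apply: measurable_sum => i; apply: measurable_funM.
      apply: eq_measurable_fun (mD (0, delta_mx 0 i)%R) => p _.
      by rewrite space_gradientE.
    apply: (measurableT_comp (f := fun y : 'rV[R]_d => y 0%R i)) mv.
    by apply: continuous_rV_measurable; exact: coord_continuous.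
  - apply: measurable_funM mw.
    exact: (continuous_spacetime_measurable (test_function_continuous tz)).
have [K K0 AK] : exists2 K, (0 <= K)%R & forall t x, (`|A t x| <= K * rate t x)%R.
  have [Cz Cz0 zC] := test_function_bounded tz.
  have [Ct Ct0 tC] := test_function_partial_bounded (1, 0)%R tz.
  have /choice[Cx HC] : forall i : 'I_d, exists C, (0 <= C)%R /\
      forall p, (`|'D_((0, delta_mx 0 i) : R * 'rV[R]_d) zeta p| <= C)%R.
    move=> i; have [C C0 xC] := test_function_partial_bounded (0, delta_mx 0 i)%R tz.
    by exists C.
  have S0 : (0 <= \sum_i Cx i)%R by apply: sumr_ge0 => i _; exact: (HC i).1.
  exists (Ct + \sum_i Cx i + Cz)%R => [|t x]; first by rewrite !addr_ge0.
  have h1 : (`|time_derivative zeta t x| <= Ct)%R by rewrite time_derivativeE.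
  have h2 : (`|dotp (space_gradient zeta t x) (v t x)| <=
      (\sum_i Cx i) * enorm (v t x))%R.
    rewrite /dotp mulr_suml; apply: (le_trans (ler_norm_sum _ _ _)).
    apply: ler_sum => i _.
    rewrite normrM ler_pM//; last exact: coord_le_enorm.
    by rewrite space_gradientE; exact: (HC i).2.
  have h3 : (`|zeta (t, x) * w t x| <= Cz * `|w t x|)%R by rewrite normrM ler_wpM2r.
  apply: (@le_trans _ _ (Ct + (\sum_i Cx i) * enorm (v t x) + Cz * `|w t x|)%R).
    apply: (le_trans (ler_normD _ _)); rewrite lerD//.
    by rewrite (le_trans (ler_normD _ _))// lerD.
  rewrite /rate; move: (enorm_ge0 (v t x)) (normr_ge0 (w t x)).
  move: (enorm _) `|w t x|%R (\sum_i Cx i)%R S0 => e u S S0 e0 u0.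
  have : (0 <= Ct * e + Ct * u + S + S * u + Cz + Cz * e)%R.
    by rewrite !addr_ge0// mulr_ge0.
  lra.
rewrite (integral_h2_time mA).
have zz := test_function_observable tz.
have mAC := measurable_along_curves mA.
have mAC' : measurable_fun [set: TC]
    (fun p => (A p.1 (xcurve p.2 p.1) * rcurve p.2 p.1 ^+ 2)%:E).
  exact/measurable_EFinP.
have mrate' : measurable_fun [set: TC]
    (fun p => (rate p.1 (xcurve p.2 p.1) * rcurve p.2 p.1 ^+ 2)%:E).
  exact/measurable_EFinP.
have irate : (leb \x eta).-integrable [set: TC]
    (fun p => (rate p.1 (xcurve p.2 p.1) * rcurve p.2 p.1 ^+ 2)%:E).
  apply/(integrable12ltyP _ _ mrate').
  move: finite_action; rewrite (integral_h2_time measurable_rate).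
  apply: le_lt_trans; rewrite le_eqVlt; apply/orP; left; apply/eqP.
  apply: eq_integral => t _; apply: eq_integral => g _.
  by rewrite gee0_abs// lee_fin mulr_ge0 ?rate_ge0 ?sqr_ge0.
have iA : (leb \x eta).-integrable [set: TC]
    (fun p => (A p.1 (xcurve p.2 p.1) * rcurve p.2 p.1 ^+ 2)%:E).
  apply: le_integrable (integrableZl measurableT K irate) => // -[t g] _ /=.
  rewrite lee_fin [leRHS]ger0_norm; last first.
    by rewrite mulr_ge0// mulr_ge0 ?rate_ge0 ?sqr_ge0.
  rewrite [leLHS]normrM [X in (_ * X <= _)%R]ger0_norm ?sqr_ge0//.
  by rewrite [leRHS]mulrA ler_wpM2r ?sqr_ge0.
rewrite (Fubini iA).
rewrite (@ae_eq_integral _ _ _ eta setT (cst 0))//.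
- exact: integral0.
- exact: measurable_fubini_G iA.
apply: (ae_imply good) => g /= [[acg _] chg] _.
rewrite -integral_restrict_time => [|t tN]; last by rewrite rcurve_out// expr0n mulr0.
have [_ ->] := observable_FTC T0 acg zz chg (lexx _) T0 (lexx _)
  (measurable_along_curve g mA).
have [-> _] := test_function_boundary (xcurve g 0) tz.
by have [_ ->] := test_function_boundary (xcurve g T) tz; rewrite !mul0r subrr.
Qed.

End superposition.

Unset Implicit Arguments.

Theorem proposition5p1 (R : realType) (d : nat) (hd : (1 <= d)%N)
  (T : R) (hT : 0 < T)
  (v : R -> 'rV[R]_d -> 'rV[R]_d) (w : R -> 'rV[R]_d -> R)
  (hv : measurable_fun (`[0, T] `*` [set: 'rV[R]_d])
     (fun p : measurableTypeR R * 'rV[R]_d => v p.1 p.2))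
  (hw : measurable_fun (`[0, T] `*` [set: 'rV[R]_d])
     (fun p : measurableTypeR R * 'rV[R]_d => w p.1 p.2))
  (eta : {finite_measure set (cone_curve d T) -> \bar R})
  (heta : eta.-negligible
     (~` [set g | AC2 T (curve_at g) /\ characteristic v w g]))
  (hint : (\int[@lebesgue_measure R]_(t in `[0%R, T])
     \int[h2 eta t]_x (1 + enorm (v t x) + `|w t x|)%:E < +oo)%E) :
  narrowly_continuous T (h2 eta) /\
  reaction_continuity_equation T v w (h2 eta).
Proof.
have mslab : measurable (`[0, T] `*` [set: 'rV[R]_d] : set (R * 'rV[R]_d)).
  by apply: measurableX; [exact: measurable_itv|exact: measurableT].
have mv := measurable_fun_time mslab hv.
have mw := measurable_fun_time mslab hw.
split; first exact: (superposition_narrowly_continuous hT mv mw heta hint).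
exact: (superposition_equation hT mv mw heta hint).
Qed.
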